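(* There is a quasipolynomial-time approximation scheme for Max-Sum Dispersion: for every $\epsilon>0$ there is an algorithm that, given a metric space $(U,d)$ with $|U|=n$ and an integer $p\ge 2$, outputs a set $S\subseteq U$ with $|S|=p$ and $\mathrm{disp}(S)\ge (1-\epsilon)\max_{S'\subseteq U,|S'|=p}\mathrm{disp}(S')$, in time $n^{O(\log n/\epsilon^4)}$.
   Context: Max-Sum Dispersion: given a finite metric space $(U,d)$ with $|U|=n$ and an integer $p\ge2$, select $S\subseteq U$ of size $p$ maximizing $\mathrm{disp}(S):=\sum_{\{u,v\}\subseteq S} d(u,v)$ (sum over unordered pairs of distinct elements). *)

(* Defs.v *)
From HB Require Import structures.
From mathcomp Require Import all_boot all_order all_algebra.
From mathcomp Require Import all_classical all_reals all_analysis.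

Set Implicit Arguments.
Unset Strict Implicit.
Unset Printing Implicit Defensive.

Import Order.TTheory GRing.Theory Num.Theory.
Local Open Scope ring_scope.

Definition is_metric (R : realType) (U : finType) (d : U -> U -> R) : Prop :=
  [/\ forall x y, 0 <= d x y,
      forall x y, d x y = 0 <-> x = y,
      forall x y, d x y = d y x
    & forall x y z, d x z <= d x y + d y z].

(* Every unordered pair {u, v} of distinct elements of S is counted exactly
   once, in the orientation given by the enumeration of U; d is symmetric
   wherever this is used. *)
Definition disp (R : realType) (U : finType) (d : U -> U -> R) (S : {set U}) :
    R :=
  \sum_(u in S) \sum_(v in S | (enum_rank u < enum_rank v)%N) d u v.

(* The default value 0 is harmless: disp is nonnegative for a metric, and there
   is a set of size p as soon as p <= #|U|. *)
Definition max_disp (R : realType) (U : finType) (d : U -> U -> R) (p : nat) :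
    R :=
  \big[Num.max/0]_(S : {set U} | #|S| == p) disp d S.

(* Model of computation: a real RAM, presented as a structured language.
   A machine has two unbounded arrays with indirect addressing, one of natural
   numbers and one of reals, read-only access to the input matrix, and an output
   stream of natural numbers.  Every operation has cost 1.  To keep the
   unit-cost model honest, naturals only have addition and truncated
   subtraction, the only literals are naturals (no real constant in which
   information could be hidden), and there is neither a floor nor any other
   operation producing a natural from a real except through comparisons. *)

Inductive nexp : Type :=
| NLit of nat
| NMem of nexp
| NAdd of nexp & nexp
| NSub of nexp & nexp.

Inductive rexp : Type :=
| RNat of nexp
| RMem of nexp
| RIn of nexp & nexp
| RAdd of rexp & rexp
| RSub of rexp & rexp
| RMul of rexp & rexp
| RDiv of rexp & rexp.

Inductive bexp : Type :=
| BNLe of nexp & nexp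
| BRLe of rexp & rexp
| BNot of bexp
| BAnd of bexp & bexp.

Inductive cmd : Type :=
| Skip
| NSet of nexp & nexp
| RSet of nexp & rexp
| Emit of nexp
| Seq of cmd & cmd
| If of bexp & cmd & cmd
| While of bexp & cmd.

Record state (R : realType) : Type := State {
  nmem : nat -> nat;
  rmem : nat -> R;
  out : seq nat
}.

Definition upd (T : Type) (m : nat -> T) (a : nat) (v : T) : nat -> T :=
  fun b => if b == a then v else m b.

Definition entry (R : realType) (n : nat) (D : 'M[R]_n) (i j : nat) : R :=
  match insub i, insub j with
  | Some i', Some j' => D i' j'
  | _, _ => 0
  end.

Fixpoint neval (m : nat -> nat) (e : nexp) : nat :=
  match e with
  | NLit k => k
  | NMem a => m (neval m a)
  | NAdd a b => (neval m a + neval m b)%N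
  | NSub a b => (neval m a - neval m b)%N
  end.

(* Division by 0 yields 0. *)
Fixpoint reval (R : realType) (n : nat) (D : 'M[R]_n) (s : state R) (e : rexp) :
    R :=
  match e with
  | RNat a => (neval (nmem s) a)%:R
  | RMem a => rmem s (neval (nmem s) a)
  | RIn a b => entry D (neval (nmem s) a) (neval (nmem s) b)
  | RAdd a b => reval D s a + reval D s b
  | RSub a b => reval D s a - reval D s b
  | RMul a b => reval D s a * reval D s b
  | RDiv a b => reval D s a / reval D s b
  end.

Fixpoint beval (R : realType) (n : nat) (D : 'M[R]_n) (s : state R) (e : bexp) :
    bool :=
  match e with
  | BNLe a b => (neval (nmem s) a <= neval (nmem s) b)%N
  | BRLe a b => reval D s a <= reval D s b
  | BNot a => ~~ beval D s a
  | BAnd a b => beval D s a && beval D s b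
  end.

Fixpoint ncost (e : nexp) : nat :=
  match e with
  | NLit _ => 1
  | NMem a => (ncost a).+1
  | NAdd a b | NSub a b => (ncost a + ncost b).+1
  end.

Fixpoint rcost (e : rexp) : nat :=
  match e with
  | RNat a | RMem a => (ncost a).+1
  | RIn a b => (ncost a + ncost b).+1
  | RAdd a b | RSub a b | RMul a b | RDiv a b => (rcost a + rcost b).+1
  end.

Fixpoint bcost (e : bexp) : nat :=
  match e with
  | BNLe a b => (ncost a + ncost b).+1
  | BRLe a b => (rcost a + rcost b).+1
  | BNot a => (bcost a).+1
  | BAnd a b => (bcost a + bcost b).+1
  end.

(* exec D c s t s': on input matrix D, the program c started in state s halts
   after t steps in state s'. *)
Inductive exec (R : realType) (n : nat) (D : 'M[R]_n) :
    cmd -> state R -> nat -> state R -> Prop :=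
| ExSkip s : exec D Skip s 1 s
| ExNSet a e s :
    exec D (NSet a e) s (ncost a + ncost e).+1
      (State (upd (nmem s) (neval (nmem s) a) (neval (nmem s) e))
             (rmem s) (out s))
| ExRSet a e s :
    exec D (RSet a e) s (ncost a + rcost e).+1
      (State (nmem s) (upd (rmem s) (neval (nmem s) a) (reval D s e)) (out s))
| ExEmit e s :
    exec D (Emit e) s (ncost e).+1
      (State (nmem s) (rmem s) (rcons (out s) (neval (nmem s) e)))
| ExSeq c1 c2 s1 s2 s3 t1 t2 :
    exec D c1 s1 t1 s2 -> exec D c2 s2 t2 s3 ->
    exec D (Seq c1 c2) s1 (t1 + t2)%N s3
| ExIf b c1 c2 s s' t :
    exec D (if beval D s b then c1 else c2) s t s' ->
    exec D (If b c1 c2) s (bcost b + t).+1 s'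
| ExWhileF b c s :
    beval D s b = false -> exec D (While b c) s (bcost b).+1 s
| ExWhileT b c s1 s2 s3 t1 t2 :
    beval D s1 b = true ->
    exec D c s1 t1 s2 -> exec D (While b c) s2 t2 s3 ->
    exec D (While b c) s1 (bcost b + t1 + t2).+1 s3.

Lemma exec_det (R : realType) (n : nat) (D : 'M[R]_n) c s t1 s1 t2 s2 :
  exec D c s t1 s1 -> exec D c s t2 s2 -> t1 = t2 /\ s1 = s2.
Proof.
move=> H; elim: H t2 s2 => {c s t1 s1}.
- by move=> s t2 s2 H; inversion H.
- by move=> a e s t2 s2 H; inversion H.
- by move=> a e s t2 s2 H; inversion H.
- by move=> e s t2 s2 H; inversion H.
- move=> c1 c2 s1 s2 s3 t1 t2 _ IH1 _ IH2 t s H.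
  inversion H as [| | | |? ? ? s4 ? t3 t4 H1 H2| | |]; subst.
  by case: (IH1 _ _ H1) => ? ?; subst; case: (IH2 _ _ H2) => -> ->.
- move=> b c1 c2 s s' t _ IH t2 s2 H.
  inversion H as [| | | | |? ? ? ? ? t3 H1| |]; subst.
  by case: (IH _ _ H1) => -> ->.
- move=> b c s Hb t2 s2 H.
  by inversion H as [| | | | | | |? ? ? ? ? ? ? Hb']; subst=> //; rewrite Hb in Hb'.
- move=> b c s1 s2 s3 t1 t2 Hb _ IH1 _ IH2 t s H.
  inversion H as [| | | | | |? ? ? Hb'|? ? ? s4 ? t3 t4 _ H1 H2]; subst.
    by rewrite Hb in Hb'.
  by case: (IH1 _ _ H1) => ? ?; subst; case: (IH2 _ _ H2) => -> ->.
Qed.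

(* The integers n and p are found in cells 0 and 1. *)
Definition init_state (R : realType) (n p : nat) : state R :=
  State (fun a => match a with 0%N => n | 1%N => p | _ => 0%N end)
        (fun=> 0) [::].

Definition dist_matrix (R : realType) (U : finType) (d : U -> U -> R) :
    'M[R]_#|U| :=
  \matrix_(i, j) d (enum_val i) (enum_val j).

(* On the instance ((U, d), p), with U presented as 0, .., #|U|-1, the program c
   halts after t steps having listed S, without repetition, on its output. *)
Definition outputs_in (R : realType) (U : finType) (d : U -> U -> R) (p : nat)
    (c : cmd) (S : {set U}) (t : nat) : Prop :=
  exists2 s : state R,
    exec (dist_matrix d) c (init_state R #|U| p) t s &
    perm_eq (out s) [seq (enum_rank u : nat) | u in S].

(* Main.v *)
Require Import Defs.
From HB Require Import structures.
From mathcomp Require Import all_boot all_order all_algebra.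
From mathcomp Require Import all_classical all_reals all_analysis.
From mathcomp Require Import fintype finset ring lra zify.
Import Order.TTheory GRing.Theory Num.Theory.
Set Implicit Arguments.
Unset Strict Implicit.
Unset Printing Implicit Defensive.
Local Open Scope ring_scope.

(** Fix an optimal set O, of total weight W(O) = 2 disp(O), and write
    B(v) = d(v, O).  Sampling k = O(log n / eps^2) points w of O with probability
    proportional to B(w) + W(O)/p, the triangle inequality bounds the reweighted
    distances d(v, w) by O(B(v) + W(O)/p), so by a Chernoff argument some sample
    estimates d(v, O \cap [h, n)) up to eps (B(v) + W(O)/p) for all points v and
    all thresholds h simultaneously.  The algorithm enumerates all samples with
    all rounded weights, together with thresholds cutting O, in index order, into
    O(1/eps^2) consecutive groups of q points.  For each guess it builds a set
    greedily: during the t-th group it adds the unused v < h_t maximizing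
    d(v, S) plus the estimate of d(v, O \cap [h_t, n)).  For the right guess,
    exchange the points of O one by one for the greedy ones: each exchange loses
    at most the estimation errors and the distances inside one group, and these
    sum up to eps W(O), because the local optimality of O gives
    B(v) <= 2 W(O)/p for v outside O. *)

(** * Sampling *)

(** With [y = x - 2 x^2], the product [(1 + x) (1 - y)] equals [1 + x^2 (1 + 2 x) >= 1], while
    [1 - y <= expR (- y)]. *)
Lemma expR_sub_sqr_le (R : realType) (x : R) :
  - 2^-1 <= x -> expR (x - 2 * x ^+ 2) <= 1 + x.
Proof.
move=> hx.
have h := expR_ge1Dx (- (x - 2 * x ^+ 2)).
have e0 := expR_gt0 (- (x - 2 * x ^+ 2)).
rewrite -[x - _]opprK expRN -[_^-1]mul1r ler_pdivrMr //.
apply: (@le_trans _ _ ((1 + x) * (1 - (x - 2 * x ^+ 2)))).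
  have : 0 <= x ^+ 2 * (1 + 2 * x) by apply: mulr_ge0; [exact: sqr_ge0 | lra].
  lra.
by rewrite ler_wpM2l //; lra.
Qed.

Lemma exists_le_mean (R : realType) (U : finType) (O : {set U}) (q : U -> R)
    (f : U -> R) :
  (forall w, w \in O -> 0 <= q w) -> \sum_(w in O) q w = 1 ->
  exists2 w, w \in O & f w <= \sum_(w in O) q w * f w.
Proof.
move=> q0 q1; apply: contrapT => h.
have hlt w : w \in O -> \sum_(w in O) q w * f w < f w.
  by move=> wO; rewrite ltNge; apply/negP => hle; apply: h; exists w.
set c := \sum_(w in O) q w * f w in hlt.
(* Some point carries positive mass, which makes the averaged inequality strict. *)
have [w wO qw] : exists2 w, w \in O & 0 < q w.
  apply: contrapT => h'; have : \sum_(w in O) q w = 0.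
    apply: big1 => w wO; apply/eqP; rewrite eq_le q0 // andbT leNgt.
    by apply/negP => qw; apply: h'; exists w.
  by rewrite q1 => /eqP; rewrite oner_eq0.
have : \sum_(w in O) q w * c < \sum_(w in O) q w * f w.
  rewrite (bigD1 w) //= [ltRHS](bigD1 w) //=.
  apply: ltr_leD; first by rewrite ltr_pM2l // hlt.
  apply: ler_sum => u /andP[uO _]; rewrite ler_wpM2l ?q0 //.
  exact/ltW/hlt.
by rewrite -mulr_suml q1 mul1r ltxx.
Qed.

(* Each sample point is chosen so that the potential
   [\sum_e \prod_i (1 + lam * Y e (w_i))], whose mean is invariant, does not
   increase. *)
Lemma exists_potential (R : realType) (U E : finType) (O : {set U}) (q : U -> R)
    (Y : E -> U -> R) (lam : R) (k : nat) :
  (forall w, w \in O -> 0 <= q w) -> \sum_(w in O) q w = 1 ->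
  (forall e, \sum_(w in O) q w * Y e w = 0) ->
  exists2 w : nat -> U, (forall i, (i < k)%N -> w i \in O) &
  \sum_e \prod_(i < k) (1 + lam * Y e (w i)) <= #|E|%:R.
Proof.
move=> q0 q1 Y0; elim: k => [|k [w wO IH]].
  have [w wO _] := exists_le_mean (fun=> 0) q0 q1.
  exists (fun=> w) => //.
  under eq_bigr do rewrite big_ord0.
  by rewrite sumr_const.
have [u uO hu] := exists_le_mean
  (fun u => \sum_e (\prod_(i < k) (1 + lam * Y e (w i))) * (1 + lam * Y e u)) q0 q1.
exists (fun i => if (i < k)%N then w i else u) => [i _|].
  by case: ifP => // /wO.
apply: le_trans IH; apply: le_trans (le_trans hu _).
  apply: ler_sum => e _; rewrite big_ord_recr /= ltnn.
  by under eq_bigr do rewrite ltn_ord.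
under eq_bigr do rewrite mulr_sumr.
rewrite exchange_big /=; apply: ler_sum => e _.
under eq_bigr => v _.
  have -> : forall P : R, q v * (P * (1 + lam * Y e v)) =
    q v * P + (P * lam) * (q v * Y e v) by move=> P; ring.
  over.
by rewrite big_split /= -mulr_suml q1 mul1r -mulr_sumr Y0 mulr0 addr0.
Qed.

(** A derandomized two-sided Chernoff bound, for all events at once. The deviations, scaled to
    [[-1, 1]] and taken with both signs (hence the index type [E * bool]), feed [exists_potential].
    One excessive deviation would make its product alone at least [expR (k delta^2 / 8)], more than
    the bound [2 #|E|] on the whole sum of nonnegative products. *)
Lemma exists_sample (R : realType) (U E : finType) (O : {set U}) (q : U -> R)
    (X : E -> U -> R) (c : E -> R) (delta : R) (k : nat) :
  (forall w, w \in O -> 0 <= q w) -> \sum_(w in O) q w = 1 ->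
  (forall e, 0 < c e) ->
  (forall e w, w \in O -> 0 <= X e w <= c e) ->
  0 < delta <= 1 ->
  2 * #|E|%:R < expR (k%:R * delta ^+ 2 / 8) ->
  exists2 w : nat -> U, (forall i, (i < k)%N -> w i \in O) &
  forall e, `|\sum_(i < k) X e (w i) - k%:R * \sum_(w in O) q w * X e w|
            <= k%:R * delta * c e.
Proof.
move=> q0 q1 c0 Xc /andP[d0 d1] hk.
pose mu e := \sum_(w in O) q w * X e w.
pose Y (eb : E * bool) w := (-1) ^+ eb.2 * ((X eb.1 w - mu eb.1) / c eb.1).
have mu_bnd e : 0 <= mu e <= c e.
  apply/andP; split.
    by apply: sumr_ge0 => w wO; rewrite mulr_ge0 ?q0 //; case/andP: (Xc e w wO).
  rewrite -[leRHS]mul1r -q1 mulr_suml; apply: ler_sum => w wO.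
  by rewrite ler_wpM2l ?q0 //; case/andP: (Xc e w wO).
have Y0 eb : \sum_(w in O) q w * Y eb w = 0.
  under eq_bigr => w _.
    have -> : q w * Y eb w = (-1) ^+ eb.2 / c eb.1 * (q w * X eb.1 w) -
      (-1) ^+ eb.2 / c eb.1 * mu eb.1 * q w by rewrite /Y; ring.
    over.
  by rewrite big_split /= -mulr_sumr sumrN -mulr_sumr q1 mulr1 /mu subrr.
have Yb eb w : w \in O -> -1 <= Y eb w <= 1.
  move=> wO; case: eb => e b; rewrite /Y /=.
  have /andP[h1 h2] := Xc e w wO; have /andP[h3 h4] := mu_bnd e.
  have : - 1 <= (X e w - mu e) / c e <= 1.
    by rewrite ler_pdivlMr // ler_pdivrMr //; apply/andP; split; lra.
  by case: b; rewrite ?expr0 ?expr1 => /andP[? ?]; apply/andP; split; lra.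
(* This maximizes [lam delta - 2 lam^2], with value [delta^2 / 8], and keeps [lam Y >= - 1/4],
   within the range of [expR_sub_sqr_le]. *)
pose lam := delta / 4.
have [w wO hw] := exists_potential lam k q0 q1 Y0.
exists w => // e.
have dev (b : bool) : (-1) ^+ b * ((\sum_(i < k) X e (w i) - k%:R * mu e) / c e) <= k%:R * delta.
  rewrite leNgt; apply/negP => hb.
  have hprod : expR (k%:R * delta ^+ 2 / 8) <= \prod_(i < k) (1 + lam * Y (e, b) (w i)).
    apply: (@le_trans _ _ (\prod_(i < k) expR (lam * Y (e, b) (w i) - 2 * lam ^+ 2))).
      rewrite -expR_sum ler_expR big_split /= -mulr_sumr sumr_const card_ord.
      have -> : \sum_(i < k) Y (e, b) (w i) =
          (-1) ^+ b * ((\sum_(i < k) X e (w i) - k%:R * mu e) / c e).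
        rewrite /Y /= -mulr_sumr -mulr_suml; congr (_ * (_ / _)).
        by rewrite sumrB sumr_const card_ord mulr_natl.
      rewrite -mulr_natl /lam.
      have : delta / 4 * (k%:R * delta) <=
        delta / 4 * ((-1) ^+ b * ((\sum_(i < k) X e (w i) - k%:R * mu e) / c e)).
        by rewrite ler_wpM2l ?(ltW hb) //; lra.
      lra.
    apply: ler_prod => i _; rewrite expR_ge0 /=.
    have /andP[y1 y2] := Yb (e, b) (w i) (wO _ (ltn_ord i)).
    have l0 : 0 <= lam by rewrite /lam; lra.
    have l1 : lam <= 4^-1 by rewrite /lam; lra.
    apply: le_trans (expR_sub_sqr_le _).
      rewrite ler_expR lerD2l lerN2 ler_wpM2l //.
      rewrite exprMn ler_piMr ?sqr_ge0 //.
      nra.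
    nra.
  have : expR (k%:R * delta ^+ 2 / 8) <= #|{: E * bool}|%:R.
    apply: le_trans hprod (le_trans _ hw).
    rewrite (bigD1 (e, b)) //= lerDl; apply: sumr_ge0 => eb _.
    apply: prodr_ge0 => i _.
    have /andP[y1 y2] := Yb eb (w i) (wO _ (ltn_ord i)).
    have l0 : 0 <= lam by rewrite /lam; lra.
    have l1 : lam <= 4^-1 by rewrite /lam; lra.
    nra.
  by rewrite card_prod card_bool natrM leNgt mulrC hk.
have := dev true; have := dev false; rewrite expr0 expr1 => h1 h2.
rewrite ler_norml -/(mu e).
move: h1 h2; rewrite mul1r mulN1r lerNl ler_pdivrMr // ler_pdivlMr // mulNr.
by move=> -> ->.
Qed.

(** * Exchange argument *)

Section Dispersion.
Variables (R : realType) (U : finType) (d : U -> U -> R).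
Hypothesis d_metric : is_metric d.

Let d_ge0 x y : 0 <= d x y. Proof. by case: d_metric. Qed.
Let d_refl x : d x x = 0. Proof. by case: d_metric => _ /(_ x x)[_ ->]. Qed.
Let d_sym x y : d x y = d y x. Proof. by case: d_metric. Qed.
Let d_tri x y z : d x z <= d x y + d y z. Proof. by case: d_metric. Qed.

Definition dist_to (v : U) (S : {set U}) : R := \sum_(s in S) d v s.
Definition weight (S : {set U}) : R := \sum_(u in S) dist_to u S.

Lemma dist_to_ge0 v S : 0 <= dist_to v S.
Proof. by apply: sumr_ge0. Qed.

Lemma weight_ge0 S : 0 <= weight S.
Proof. by apply: sumr_ge0 => u _; exact: dist_to_ge0. Qed.

Lemma dist_toU1 v x (S : {set U}) : x \notin S -> dist_to v (x |: S) = d v x + dist_to v S.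
Proof. exact: big_setU1. Qed.

Lemma dist_toD1 v x (S : {set U}) : x \in S -> dist_to v S = d v x + dist_to v (S :\ x).
Proof. by move=> xS; rewrite /dist_to (big_setD1 x). Qed.

Lemma dist_toU v (S T : {set U}) : [disjoint S & T] ->
  dist_to v (S :|: T) = dist_to v S + dist_to v T.
Proof.
move=> ST; rewrite /dist_to.
by under eq_bigl do rewrite inE; rewrite bigU.
Qed.

Lemma weightU1 x (S : {set U}) : x \notin S -> weight (x |: S) = weight S + 2 * dist_to x S.
Proof.
move=> xS; rewrite /weight big_setU1 //= dist_toU1 // d_refl add0r.
under eq_bigr do rewrite dist_toU1 //.
rewrite big_split /=.
have -> : \sum_(i in S) d i x = dist_to x S by apply: eq_bigr => i _; rewrite d_sym.
by rewrite /weight; lra.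
Qed.

Lemma weight_disp S : weight S = 2 * disp d S.
Proof.
rewrite /weight /disp mulr_natl mulr2n.
have -> : \sum_(u in S) dist_to u S =
    \sum_(u in S) \sum_(v in S | (enum_rank u < enum_rank v)%N) d u v +
    \sum_(u in S) \sum_(v in S | (enum_rank v < enum_rank u)%N) d u v.
  rewrite -big_split /=; apply: eq_bigr => u uS.
  rewrite /dist_to (bigID (fun v => (enum_rank u < enum_rank v)%N)) /=; congr (_ + _).
  rewrite [LHS](bigID (pred1 u)) /= big1 ?add0r => [|v /andP[_ /eqP ->]]; last exact: d_refl.
  apply: eq_bigl => v; rewrite -andbA; congr (_ && _).
  rewrite -leqNgt (leq_eqVlt (enum_rank v)).
  have -> : (enum_rank v == enum_rank u :> nat) = (v == u).
    by rewrite -(inj_eq enum_rank_inj).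
  by case: (eqVneq v u) => [->|] /=; rewrite ?ltnn ?andbF ?andbT.
congr (_ + _); rewrite (exchange_big_dep (mem S)) /=; last by move=> ? ? _ /andP[].
apply: eq_bigr => u uS; apply: eq_big => v; first by rewrite uS.
by move=> _; exact: d_sym.
Qed.

Variables (O : {set U}) (p : nat).
Hypothesis p_ge2 : (2 <= p)%N.
Hypothesis card_O : #|O| = p.
Hypothesis O_max : forall S : {set U}, #|S| = p -> weight S <= weight O.

Let p_gt0 : 0 < p%:R :> R. Proof. by rewrite ltr0n; lia. Qed.

(** Sum the triangle inequality through [s] over all [s] in [O]. *)
Lemma avg_triangle v w : p%:R * d v w <= dist_to v O + dist_to w O.
Proof.
rewrite -card_O mulr_natl -sumr_const /dist_to -big_split /=.
by apply: ler_sum => s _; rewrite (d_sym w).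
Qed.

Lemma weight_opt_gt0 : 0 < weight O.
Proof.
have /card_gt1P[x [y [xO yO xy]]] : (1 < #|O|)%N by rewrite card_O.
have dxy : 0 < d x y.
  rewrite lt_neqAle d_ge0 andbT eq_sym; apply/eqP.
  by case: d_metric => _ /(_ x y)[h _] _ _ /h /eqP; apply/negP.
rewrite /weight (bigD1 x) //= /dist_to (bigD1 y) //= -addrA ltr_wpDr //.
by apply: addr_ge0; apply: sumr_ge0 => // u _; apply: sumr_ge0.
Qed.

(** Exchanging any [w] of [O] for [u] cannot increase the weight. Summing over [w] gives
    [(p - 1) dist_to u O <= weight O], and [p <= 2 (p - 1)]. *)
Lemma dist_to_opt_out u : u \notin O -> p%:R * dist_to u O <= 2 * weight O.
Proof.
move=> uO.
have h w : w \in O -> dist_to u O - d u w <= dist_to w O.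
  move=> wO.
  have uOw : u \notin O :\ w by rewrite !inE (negbTE uO) andbF.
  have : weight (u |: (O :\ w)) <= weight O.
    apply: O_max; rewrite cardsU1 uOw; have := cardsD1 w O; rewrite wO card_O; lia.
  rewrite -[X in _ <= weight X](setD1K wO) !weightU1 ?setD11 //.
  rewrite (dist_toD1 u wO) (dist_toD1 w wO) d_refl; lra.
have : \sum_(w in O) (dist_to u O - d u w) <= weight O by apply: ler_sum.
rewrite big_split /= sumr_const sumrN -/(dist_to u O) card_O -mulr_natl.
have : 2 <= p%:R :> R by rewrite ler_nat.
have := dist_to_ge0 u O; nra.
Qed.

(** The points of [Z] inside [O] contribute at most [weight O]; each of the others contributes at
    most [2 weight O / p]. *)
Lemma sum_dist_to_opt (Z : {set U}) : #|Z| = p ->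
  \sum_(z in Z) dist_to z O <= 3 * weight O.
Proof.
move=> cZ; rewrite (bigID (mem O)) /=.
have h1 : \sum_(z in Z | z \in O) dist_to z O <= weight O.
  rewrite /weight [leRHS](bigID (mem Z)) /=.
  under eq_bigl do rewrite andbC.
  by rewrite lerDl; apply: sumr_ge0 => u _; exact: dist_to_ge0.
have h2 : \sum_(z in Z | z \notin O) dist_to z O <= \sum_(z in Z) (2 * weight O / p%:R).
  apply: (@le_trans _ _ (\sum_(z in Z | z \notin O) (2 * weight O / p%:R))).
    apply: ler_sum => z /andP[_ zO].
    by rewrite ler_pdivlMr // mulrC dist_to_opt_out.
  rewrite [leRHS](bigID (mem O)) /= lerDr sumr_ge0 // => u _.
  by rewrite divr_ge0 ?(ltW p_gt0) // mulr_ge0 ?weight_ge0.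
move: h2; rewrite sumr_const cZ -[(_ / _) *+ p]mulr_natl mulrCA divff ?gt_eqF // mulr1.
lra.
Qed.

(** * Index thresholds and the sampled estimator *)

Variables (r : U -> nat) (n : nat).
Hypothesis r_inj : injective r.
Hypothesis r_lt : forall x, (r x < n)%N.

Definition above (h : nat) : {set U} := [set s in O | (h <= r s)%N].

Lemma above_le h h' : (h <= h')%N -> above h' \subset above h.
Proof.
move=> hh; apply/subsetP => s; rewrite !inE => /andP[-> /=].
exact: leq_trans.
Qed.

(* The number of points above a threshold drops by at most one when the
   threshold moves by one, so every value is attained. *)
Lemma exists_threshold :
  exists thr : nat -> nat, [/\ forall c, (c <= p)%N -> #|above (thr c)| = c,
    forall c c', (c <= c')%N -> (thr c' <= thr c)%N &
    forall c, (thr c <= n)%N].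
Proof.
have ex c : exists h, (#|above h| <= c)%N.
  exists n; rewrite (_ : above n = set0) ?cards0 //.
  by apply/setP => s; rewrite !inE leqNgt r_lt andbF.
exists (fun c => ex_minn (ex c)); split=> [c cp|c c' cc|c].
- case: ex_minnP => h hc hmin; apply/eqP; rewrite eqn_leq hc /=.
  case: h hc hmin => [|h] hc hmin.
    suff -> : above 0 = O by rewrite card_O.
    by apply/setP => s; rewrite !inE leq0n andbT.
  have hlt : (c < #|above h|)%N.
    by rewrite ltnNge; apply/negP => /hmin; rewrite ltnn.
  have sub : above h :\: above h.+1 \subset [set s | r s == h].
    by apply/subsetP => s; rewrite !inE; case: (s \in O) => //=; rewrite -leqNgt eqn_leq.
  have : (#|above h :\: above h.+1| <= 1)%N.
    apply: leq_trans (subset_leq_card sub) _.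
    by apply/card_le1_eqP => x y; rewrite !inE => /eqP hx /eqP hy; apply: r_inj; rewrite hx hy.
  rewrite cardsD (setIidPr (above_le (leqnSn h))) leq_subLR addn1.
  by move/(leq_trans hlt).
- case: ex_minnP => h hc hmin; case: ex_minnP => h' hc' hmin'.
  by apply: hmin; apply: leq_trans cc.
- case: ex_minnP => h hc; apply.
  rewrite (_ : above n = set0) ?cards0 //.
  by apply/setP => s; rewrite !inE leqNgt r_lt andbF.
Qed.

Variables (q : nat) (delta : R) (thr : nat -> nat).
Hypothesis q_gt0 : (0 < q)%N.
Hypothesis delta_ge0 : 0 <= delta.
Hypothesis thr_card : forall c, (c <= p)%N -> #|above (thr c)| = c.
Hypothesis thr_anti : forall c c', (c <= c')%N -> (thr c' <= thr c)%N.

(** Step [j] belongs to group [j %/ q], and only the optimal points of later groups lie above its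
    threshold. In the last group the truncated subtraction yields [thr 0], above which no optimal
    point lies. *)
Definition step_thr (j : nat) : nat := thr (p - (j %/ q).+1 * q).
Definition est_err (v : U) : R := delta * (weight O / p%:R + dist_to v O).

Lemma est_err_ge0 v : 0 <= est_err v.
Proof.
by rewrite mulr_ge0 // addr_ge0 ?dist_to_ge0 // divr_ge0 ?weight_ge0 // ltW.
Qed.

(** Importance sampling: [w] is drawn with probability [qq w] and reweighted by its inverse [a w],
    rounded down to the multiple [A w / M] of [1 / M] so that it can be guessed as a natural number.
    The events of [exists_sample] are the pairs of a point and a threshold in [0 .. n]. *)
Lemma exists_estimator (M k : nat) :
  n = #|U| -> 0 < delta <= 1 -> 3 <= M%:R * delta -> (0 < k)%N ->
  2 * (n%:R * n.+1%:R) < expR (k%:R * (delta / 3) ^+ 2 / 8) ->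
  exists (w : nat -> U) (A : nat -> nat), (forall i, (A i <= 2 * M * p)%N) /\
  forall v h, (h <= n)%N ->
    `|(\sum_(i < k) (if (h <= r (w i))%N then (A i)%:R * d v (w i) else 0)) /
       (k%:R * M%:R) - dist_to v (above h)| <= est_err v.
Proof.
move=> nU /andP[d0 d1] hM k0 hk.
have {nU hk} hE : 2 * #|{: U * 'I_n.+1}|%:R < expR (k%:R * (delta / 3) ^+ 2 / 8).
  by rewrite card_prod card_ord -nU natrM.
have M0 : 0 < M%:R :> R by rewrite ltNge; apply/negP => ?; nra.
have k0R : 0 < k%:R :> R by rewrite ltr0n.
set Om := weight O; have Om0 : 0 < Om := weight_opt_gt0.
pose m := Om / p%:R; have m0 : 0 < m by rewrite divr_gt0.
have pm : p%:R * m = Om by rewrite /m mulrCA divff ?gt_eqF // mulr1.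
pose B v := dist_to v O.
have B0 v : 0 <= B v := dist_to_ge0 v O.
(* The total mass is 1, since both [B] and the constant [m] sum to [Om] over [O]. The term [m] keeps
   every [a w] at most [2 p]. *)
pose qq w := (B w + m) / (2 * Om).
pose a w := 2 * Om / (B w + m).
have Bm0 w : 0 < B w + m by rewrite ltr_wpDl.
have qq0 w : w \in O -> 0 <= qq w by rewrite divr_ge0 // ?mulr_ge0 // ltW.
have qq1 : \sum_(w in O) qq w = 1.
  rewrite -mulr_suml big_split /= -/(weight O) sumr_const card_O -[m *+ p]mulr_natl pm -/Om.
  have -> : Om + Om = 2 * Om by ring.
  by rewrite divff // gt_eqF // mulr_gt0.
have qa w : qq w * a w = 1.
  by rewrite /qq /a; field; rewrite !gt_eqF.
have a0 w : 0 <= a w by rewrite divr_ge0 // ?mulr_ge0 // ltW.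
pose A w := Num.truncn (M%:R * a w).
have Aitv w : (A w)%:R <= M%:R * a w < (A w).+1%:R.
  by apply: truncn_itv; rewrite mulr_ge0 // ltW.
have a_le w : a w <= 2 * p%:R.
  rewrite /a ler_pdivrMr // -mulrA ler_pM2l //.
  by rewrite mulrDr pm lerDr mulr_ge0 // ltW.
have A_le w : (A w <= 2 * M * p)%N.
  rewrite -(ler_nat R) !natrM; have /andP[h _] := Aitv w.
  by apply: le_trans h _; have := a_le w; nra.
pose X (e : U * 'I_n.+1) w :=
  if (e.2 <= r w)%N then (A w)%:R / M%:R * d e.1 w else 0.
pose c (e : U * 'I_n.+1) := 2 * (m + B e.1).
have c0 e : 0 < c e by rewrite mulr_gt0 // ltr_pwDl.
have AM w : (A w)%:R / M%:R <= a w.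
  by rewrite ler_pdivrMr // mulrC; case/andP: (Aitv w).
have AM0 w : 0 <= (A w)%:R / M%:R :> R by rewrite divr_ge0 // ltW.
have Xc e w : w \in O -> 0 <= X e w <= c e.
  move=> wO; rewrite /X; case: ifP => _; last by rewrite lexx ltW.
  rewrite mulr_ge0 //=.
  apply: (@le_trans _ _ (a w * d e.1 w)); first by rewrite ler_wpM2r.
  rewrite /a mulrAC ler_pdivrMr // /c -!mulrA ler_pM2l //.
  (* By the averaged triangle inequality, [a w d(v, w) <= 2 m (B v + B w) / (B w + m)], which is at
     most [2 (m + B v)]. *)
  have := avg_triangle e.1 w; rewrite -/(B _) -/(B _) => ht.
  rewrite -pm mulrAC mulrC.
  have := B0 e.1; have := B0 w; nra.
have dl : 0 < delta / 3 <= 1 by apply/andP; split; lra.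
have [w wO hw] := exists_sample qq0 qq1 c0 Xc dl hE.
exists w, (fun i => A (w i)); split=> // v h hn.
have {hw} := hw (v, inord h); set mu := \sum_(w in O) _ => hw.
have eX i : X (v, inord h) (w i) =
    (if (h <= r (w i))%N then (A (w i))%:R * d v (w i) else 0) / M%:R.
  by rewrite /X /= inordK //; case: ifP => _; rewrite ?mul0r // mulrAC.
move: hw; under eq_bigr do rewrite eX.
rewrite -mulr_suml; set s := \sum_(i < k) _ => hw.
set D := dist_to v (above h).
have D0 : 0 <= D by apply: dist_to_ge0.
have DB : D <= B v.
  rewrite /B /dist_to [leRHS](bigID (mem (above h))) /=.
  rewrite (_ : \sum_(i in O | _) _ = D) ?lerDl ?sumr_ge0 //.
  by apply: eq_bigl => s'; rewrite !inE; case: (s' \in O).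
have muE : mu = \sum_(s in above h) qq s * ((A s)%:R / M%:R) * d v s.
  rewrite /mu [RHS](eq_bigl (fun s => (s \in O) && (h <= r s)%N)); last by move=> s'; rewrite inE.
  rewrite big_mkcondr; apply: eq_bigr => u uO; rewrite /X /= inordK //.
  by case: ifP => _; rewrite ?mulr0 // mulrA.
have mu_le : mu <= D.
  rewrite muE; apply: ler_sum => u uh; rewrite ler_piMl //.
  have uO : u \in O by move: uh; rewrite inE => /andP[].
  by apply: le_trans (ler_wpM2l (qq0 u uO) (AM u)) _; rewrite qa.
(* Weights of at least 1 turn the absolute rounding error [1 / M] into a relative one. *)
have a1 u : u \in O -> 1 <= a u.
  move=> uO; rewrite /a ler_pdivlMr // mul1r mulr_natl mulr2n; apply: lerD.
    by rewrite /Om /weight (bigD1 u) //= lerDl sumr_ge0 // => *; exact: B0.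
  by rewrite /m ler_pdivrMr // ler_peMr ?(ltW Om0) // ler1n; exact: ltnW.
have mu_ge : (1 - M%:R^-1) * D <= mu.
  rewrite muE /D /dist_to mulr_sumr; apply: ler_sum => u; rewrite inE => /andP[uO _].
  rewrite ler_wpM2r //.
  have -> : 1 - M%:R^-1 = qq u * (a u - a u / M%:R) :> R.
    by rewrite mulrBr qa (mulrA (qq u)) qa mul1r.
  rewrite ler_wpM2l ?qq0 // ler_pdivlMr // mulrBl mulfVK ?gt_eqF //.
  have /andP[_] := Aitv u; rewrite -natr1; have := a1 u uO; lra.
have Minv : M%:R^-1 <= delta / 3.
  by rewrite -[M%:R^-1]mul1r ler_pdivrMr //; lra.
have muD : `|mu - D| <= delta / 3 * B v.
  rewrite ler_norml; apply/andP; split; last first.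
    by apply: le_trans (_ : 0 <= _); rewrite ?subr_le0 // mulr_ge0 // divr_ge0.
  have : M%:R^-1 * D <= delta / 3 * B v by rewrite ler_pM // invr_ge0 ltW.
  lra.
have e1 : s / (k%:R * M%:R) - D = (s / M%:R - k%:R * mu) / k%:R + (mu - D).
  by field; rewrite !gt_eqF.
rewrite e1; apply: le_trans (ler_normD _ _) _.
have h1 : `|(s / M%:R - k%:R * mu) / k%:R| <= delta / 3 * c (v, inord h).
  rewrite normrM normfV (gtr0_norm k0R) ler_pdivrMr //.
  by apply: le_trans hw _; rewrite -mulrA mulrC.
apply: le_trans (lerD h1 muD) _.
rewrite /c /est_err /= -/(B v) -/Om -/m.
(* Sampling costs [2 (delta / 3) (m + B v)] and rounding costs [(delta / 3) B v]. *)
have : 0 <= delta * m by rewrite mulr_ge0 // ltW.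
lra.
Qed.

(** The price of swapping [x] out: up to [q - 1] distances inside its group, each at most
    [2 dist_to x O / p], plus the estimation error at [x]. The outer factor 2 is there because
    [weight] counts ordered pairs. *)
Definition swap_loss (x : U) : R :=
  2 * (2 * (q.-1)%:R * dist_to x O / p%:R + est_err x).

Lemma swap_loss_ge0 x : 0 <= swap_loss x.
Proof.
rewrite mulr_ge0 // addr_ge0 ?est_err_ge0 // divr_ge0 ?(ltW p_gt0) //.
by rewrite mulr_ge0 ?dist_to_ge0 // mulr_ge0.
Qed.

(* The partial greedy solution S is completed by the part P of the optimum that
   has not been swapped out yet. *)
Definition hybrid (j : nat) (S P : {set U}) : Prop :=
  [/\ P \subset O, [disjoint S & P], #|S| = j & #|P| = (p - j)%N] /\
  [/\ above (step_thr j) \subset P &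
  weight O <= weight (S :|: P) + \sum_(x in O :\: P) swap_loss x
              + \sum_(z in S) 2 * est_err z].

Lemma hybrid0 : hybrid 0 set0 O.
Proof.
split; split; rewrite ?cards0 ?card_O ?subn0 //.
- by rewrite -setI_eq0 set0I.
- by apply/subsetP => s; rewrite inE => /andP[].
- by rewrite set0U setDv !big_set0 !addr0.
Qed.

Lemma step_thr_mono j : (step_thr j <= step_thr j.+1)%N.
Proof.
apply: thr_anti; have := leq_div2r q (leqnSn j); nia.
Qed.

(** [P] has [p - j] points, of which [p - (j %/ q).+1 * q] lie above the threshold, and
    [j < (j %/ q).+1 * q <= j + q]. When the subtraction truncates, [j < p] still leaves a point. *)
Lemma hybrid_room (j : nat) (S P : {set U}) :
  (j < p)%N -> hybrid j S P -> (0 < #|P :\: above (step_thr j)| <= q)%N.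
Proof.
move=> jp [[_ _ _ cP] [LP _]].
have cL : #|above (step_thr j)| = (p - (j %/ q).+1 * q)%N by rewrite thr_card // leq_subr.
have jq : (j < (j %/ q).+1 * q <= j + q)%N.
  by have := divn_eq j q; have := ltn_pmod j q_gt0; clear; lia.
by rewrite cardsD (setIidPr LP) cP cL; clear -jp jq; lia.
Qed.

Lemma hybrid_avail (j : nat) (S P : {set U}) :
  (j < p)%N -> hybrid j S P -> exists2 x, x \notin S & (r x < step_thr j)%N.
Proof.
move=> jp hyb; have /andP[/card_gt0P[x]] := hybrid_room jp hyb.
have [[PO SP _ _] _] := hyb.
rewrite !inE => /andP[xh xP] _; exists x.
  by rewrite (disjointFl SP xP).
by move: xh; rewrite (subsetP PO) //= -ltnNge.
Qed.

(** The exchange step: [g] is the estimated gain and [z] the greedy choice. Its estimation errors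
    are charged to [z] and to the point [x] that leaves [P]; the distances inside the group are
    charged to [x]. *)
Lemma hybrid_step (j : nat) (S P : {set U}) (g : U -> R) (z : U) :
  (j < p)%N -> hybrid j S P -> z \notin S -> (r z < step_thr j)%N ->
  (forall v, v \notin S -> (r v < step_thr j)%N -> g v <= g z) ->
  (forall v, `|g v - (dist_to v S + dist_to v (above (step_thr j)))| <= est_err v) ->
  exists P', hybrid j.+1 (z |: S) P'.
Proof.
move=> jp hyb zS rz gz gerr; have [[PO SP cS cP] [LP hW]] := hyb.
set h := step_thr j in LP rz gz gerr.
have LS : above (step_thr j.+1) \subset above h by apply: above_le; exact: step_thr_mono.
(* If the greedy choice is still in [P], it moves from [P] to [S] and the union is unchanged. *)
case: (boolP (z \in P)) => zP.
  exists (P :\ z); split; split.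
  - by apply: subset_trans PO; exact: subD1set.
  - rewrite -setI_eq0; apply/eqP/setP => y; rewrite !inE.
    case: (eqVneq y z) => //= _; apply/negP => /andP[yS yP].
    by move/disjointFr: SP => /(_ _ yS); rewrite yP.
  - by rewrite cardsU1 zS cS.
  - by rewrite subnS -cP (cardsD1 z P) zP.
  - apply: subset_trans LS _; apply/subsetP => y yL.
    rewrite !inE (subsetP LP) // andbT; apply/eqP => yz.
    by move: yL; rewrite yz !inE leqNgt rz andbF.
  have -> : z |: S :|: P :\ z = S :|: P.
    apply/setP => y; rewrite !inE; case: (eqVneq y z) => [->|] //=.
    by rewrite zP orbT.
  rewrite [X in _ + X]big_setU1 //=.
  have : \sum_(x in O :\: P) swap_loss x <= \sum_(x in O :\: (P :\ z)) swap_loss x.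
    rewrite [leRHS](bigID (mem (O :\: P))) /=.
    rewrite (_ : \sum_(i in _ | _) _ = \sum_(x in O :\: P) swap_loss x).
      by rewrite lerDl sumr_ge0 // => x _; exact: swap_loss_ge0.
    apply: eq_bigl => y; rewrite !inE.
    by case: (y \in P); case: (y \in O) => /=; rewrite ?andbF ?orbT.
  have := est_err_ge0 z; lra.
pose Q := P :\: above h.
have cQ : (0 < #|Q| <= q)%N := hybrid_room jp hyb.
have /card_gt0P[x0 x0Q] : (0 < #|Q|)%N by case/andP: cQ.
(* Removing the point of the group farthest from [O] bounds every distance [d(x, y)] inside the
   group by [2 dist_to x O / p]. *)
have [x xQ xmax] : exists2 x, x \in Q & forall y, y \in Q -> dist_to y O <= dist_to x O.
  case: (@arg_maxP _ _ _ x0 (mem Q) (fun y => dist_to y O) x0Q) => x xQ h'.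
  by exists x.
have [xL xP] : x \notin above h /\ x \in P by move: xQ; rewrite inE => /andP[].
have xO : x \in O by apply: (subsetP PO).
have xS : x \notin S by apply/negP => xS; move/disjointFr: SP => /(_ _ xS); rewrite xP.
have rx : (r x < h)%N by move: xL; rewrite inE xO /= -ltnNge.
have zx : z != x by apply/eqP => zx; rewrite zx xP in zP.
exists (P :\ x); split; split.
- by apply: subset_trans PO; exact: subD1set.
- rewrite -setI_eq0; apply/eqP/setP => y; rewrite !inE.
  case: (eqVneq y z) => [->|] /=; first by rewrite (negbTE zP) andbF.
  move=> _; apply/negP => /andP[yS /andP[_ yP]].
  by move/disjointFr: SP => /(_ _ yS); rewrite yP.
- by rewrite cardsU1 zS cS.
- by rewrite subnS -cP (cardsD1 x P) xP.
- apply: subset_trans LS _; apply/subsetP => y yL.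
  rewrite !inE (subsetP LP) // andbT; apply/eqP => yx.
  by move: yL; rewrite yx (negbTE xL).
pose H := S :|: P :\ x.
have xH : x \notin H by rewrite !inE (negbTE xS) eqxx.
have zH : z \notin H by rewrite !inE (negbTE zS) (negbTE zP) andbF.
have -> : z |: S :|: P :\ x = z |: H by rewrite /H setUA.
have eH : S :|: P = x |: H by rewrite /H setUCA setD1K.
move: hW; rewrite eH !weightU1 // => hW.
have -> : O :\: (P :\ x) = x |: (O :\: P).
  apply/setP => y; rewrite !inE; case: (eqVneq y x) => [->|] //=; by rewrite ?xO ?andbT.
rewrite [X in _ + X]big_setU1 //= [X in _ + X + _]big_setU1 /=; last by rewrite inE xP.
have SL : [disjoint S & above h] by apply: disjointWr LP SP.
(* The distances to [S] and to [above h] are what the greedy rule compares; only those to [Q :\ x]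
   escape it, and they can only help [z]. *)
have eH2 : H = (S :|: above h) :|: (Q :\ x).
  apply/setP => y; rewrite !inE; case: (eqVneq y x) => [->|] /=.
    by rewrite (negbTE xS) xO leqNgt rx.
  move=> _; case: (boolP (y \in P)) => yP; first by case: (y \in S); case: (_ && _).
  rewrite andbF orbF (_ : _ && _ = false) ?orbF //; apply/negP => yL.
  by move/negP: yP; apply; apply: (subsetP LP); rewrite inE.
have dH : [disjoint S :|: above h & Q :\ x].
  rewrite -setI_eq0; apply/eqP/setP => y; rewrite in_set0; apply/negP.
  rewrite in_setI in_setU => /andP[/orP[yS|yL]]; rewrite in_setD1 in_setD.
    by move/disjointFr: SP => /(_ _ yS) ->; rewrite !andbF.
  by rewrite yL /= andbF.
have hz : dist_to z S + dist_to z (above h) <= dist_to z H.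
  by rewrite eH2 dist_toU // dist_toU // lerDl dist_to_ge0.
have hx : dist_to x H = dist_to x S + dist_to x (above h) + dist_to x (Q :\ x).
  by rewrite eH2 dist_toU // dist_toU.
have hQ : dist_to x (Q :\ x) <= 2 * (q.-1)%:R * dist_to x O / p%:R.
  rewrite ler_pdivlMr // mulrC.
  apply: (@le_trans _ _ (\sum_(y in Q :\ x) 2 * dist_to x O)).
    rewrite {1}/dist_to mulr_sumr; apply: ler_sum => y; rewrite inE => /andP[_ yQ].
    apply: le_trans (avg_triangle x y) _.
    by rewrite mulr_natl mulr2n lerD2l xmax.
  rewrite sumr_const -[_ *+ #|_|]mulr_natl mulrCA -mulrA ler_pM2l //.
  rewrite ler_wpM2r ?dist_to_ge0 // ler_nat.
  by case/andP: cQ => _; rewrite (cardsD1 x Q) xQ add1n => cQ; rewrite -ltnS prednK.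
have := gz x xS rx; have := gerr x; have := gerr z; rewrite !ler_norml.
move=> /andP[gz1 gz2] /andP[gx1 gx2] gxz; rewrite /swap_loss; lra.
Qed.

(** At the end [P] is empty. The swap losses over [O] sum to [(4 (q - 1) / p + 4 delta) weight O];
    the errors over [S] sum to at most [2 delta (1 + 3) weight O], by [sum_dist_to_opt]. *)
Lemma hybrid_end (S P : {set U}) : hybrid p S P ->
  (1 - 4 * (q.-1)%:R / p%:R - 12 * delta) * weight O <= weight S.
Proof.
move=> [[PO SP cS cP] [LP hW]].
have P0 : P = set0 by apply/eqP; rewrite -cards_eq0 cP subnn.
move: hW; rewrite P0 setU0 setD0.
have -> : \sum_(x in O) swap_loss x =
    (4 * (q.-1)%:R / p%:R + 4 * delta) * weight O.
  rewrite /swap_loss -mulr_sumr big_split /= /est_err -mulr_sumr big_split /=.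
  rewrite -mulr_suml -mulr_sumr sumr_const card_O -[(_ / _) *+ p]mulr_natl.
  rewrite [p%:R * _]mulrCA divff ?gt_eqF // mulr1 -/(weight O); ring.
have : \sum_(z in S) 2 * est_err z <= 8 * delta * weight O.
  rewrite -mulr_sumr /est_err -mulr_sumr big_split /= sumr_const cS.
  rewrite -[(_ / _) *+ p]mulr_natl [p%:R * _]mulrCA divff ?gt_eqF // mulr1.
  have := ler_wpM2l delta_ge0 (sum_dist_to_opt cS); lra.
lra.
Qed.

End Dispersion.

(** * Cost-annotated weakest preconditions *)

(* Over-approximation of the cells a command may write: indirect addresses are
   only recognised in the form [literal + index]. *)
Fixpoint nwrites (c : cmd) (x : nat) : bool :=
  match c with
  | NSet (NLit a) _ => x == a
  | NSet (NAdd (NLit a) _) _ => (a <= x)%N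
  | NSet _ _ => true
  | Seq c1 c2 | If _ c1 c2 => nwrites c1 x || nwrites c2 x
  | While _ c => nwrites c x
  | _ => false
  end.

Fixpoint rwrites (c : cmd) (x : nat) : bool :=
  match c with
  | RSet (NLit a) _ => x == a
  | RSet (NAdd (NLit a) _) _ => (a <= x)%N
  | RSet _ _ => true
  | Seq c1 c2 | If _ c1 c2 => rwrites c1 x || rwrites c2 x
  | While _ c => rwrites c x
  | _ => false
  end.

Fixpoint emits (c : cmd) : bool :=
  match c with
  | Emit _ => true
  | Seq c1 c2 | If _ c1 c2 => emits c1 || emits c2
  | While _ c => emits c
  | _ => false
  end.

Definition var (a : nat) : nexp := NMem (NLit a).

Definition For (i b : nat) (c : cmd) : cmd :=
  Seq (NSet (NLit i) (NLit 0))
      (While (BNot (BNLe (var b) (var i)))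
             (Seq c (NSet (NLit i) (NAdd (var i) (NLit 1))))).

Section Exec.
Variables (R : realType) (n : nat) (D : 'M[R]_n).
Implicit Types (s : state R) (c : cmd).

(** The frame condition: with it, loop invariants mention only the cells that matter. *)
Definition agrees c s s' : Prop :=
  [/\ forall x, ~~ nwrites c x -> nmem s' x = nmem s x,
      forall x, ~~ rwrites c x -> rmem s' x = rmem s x &
      ~~ emits c -> out s' = out s].

Lemma agrees_refl c s : agrees c s s. Proof. by []. Qed.

Lemma agrees_trans c s1 s2 s3 : agrees c s1 s2 -> agrees c s2 s3 -> agrees c s1 s3.
Proof.
move=> [n1 r1 o1] [n2 r2 o2]; split=> [x h|x h|h].
- by rewrite n2 ?n1.
- by rewrite r2 ?r1.
- by rewrite o2 ?o1.
Qed.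

Lemma agn c s s' x : agrees c s s' -> ~~ nwrites c x -> nmem s' x = nmem s x.
Proof. by case=> h _ _; exact: h. Qed.

Lemma agr c s s' x : agrees c s s' -> ~~ rwrites c x -> rmem s' x = rmem s x.
Proof. by case=> _ h _; exact: h. Qed.

Lemma ago c s s' : agrees c s s' -> ~~ emits c -> out s' = out s.
Proof. by case=> _ _ h; exact: h. Qed.

Lemma exec_agrees c s t s' : exec D c s t s' -> agrees c s s'.
Proof.
elim=> {c s t s'} //=.
- move=> [a|a|a b|a b] e s; split=> //= x; rewrite /upd.
  + by move=> /negbTE ->.
  + case: a => [a|a|a a'|a a'] //=; rewrite -ltnNge => h.
    by case: eqP => // hx; rewrite hx in h; lia.
- move=> [a|a|a b|a b] e s; split=> //= x; rewrite /upd.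
  + by move=> /negbTE ->.
  + case: a => [a|a|a a'|a a'] //=; rewrite -ltnNge => h.
    by case: eqP => // hx; rewrite hx in h; lia.
- move=> c1 c2 s1 s2 s3 t1 t2 _ [n1 r1 o1] _ [n2 r2 o2].
  split=> [x|x|]; rewrite negb_or => /andP[h1 h2].
  + by rewrite n2 ?n1.
  + by rewrite r2 ?r1.
  + by rewrite o2 ?o1.
- move=> b c1 c2 s s' t _; case: (beval D s b) => -[n1 r1 o1];
  by split=> [x|x|]; rewrite negb_or => /andP[h1 h2]; auto.
- move=> b c s1 s2 s3 t1 t2 _ _ h1 _ h2.
  exact: agrees_trans h1 h2.
Qed.

Definition setn s a v : state R := State (upd (nmem s) a v) (rmem s) (out s).
Definition setr s a v : state R := State (nmem s) (upd (rmem s) a v) (out s).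

Variable X : nat.
Hypothesis X_ge : (100 <= X)%N.

(* X bounds all sizes that occur, so time is only tracked up to the exponent e. *)
Definition wp c (e : nat) s (Q : state R -> Prop) : Prop :=
  exists t s', [/\ exec D c s t s', (t <= X ^ e)%N & Q s'].

Let X_gt0 : (0 < X)%N. Proof. by apply: leq_trans X_ge. Qed.

(** The consequence rule with the frame rule built in: the new postcondition may rely on
    [agrees]. *)
Lemma wp_mono c e e' s (Q Q' : state R -> Prop) : (e <= e')%N ->
  (forall s', agrees c s s' -> Q s' -> Q' s') -> wp c e s Q -> wp c e' s Q'.
Proof.
move=> ee QQ [t [s' [ex tX Qs]]]; exists t, s'; split=> //.
  by apply: leq_trans tX _; rewrite leq_pexp2l.
by apply: QQ => //; exact: exec_agrees ex.
Qed.

Lemma wp_skip s (Q : state R -> Prop) : Q s -> wp Skip 1 s Q.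
Proof. by move=> h; exists 1%N, s; split=> //; exact: ExSkip. Qed.

Lemma wp_nset a e s (Q : state R -> Prop) : (ncost a + ncost e < 100)%N ->
  Q (setn s (neval (nmem s) a) (neval (nmem s) e)) -> wp (NSet a e) 1 s Q.
Proof.
move=> h Qs; eexists; eexists; split; [exact: ExNSet | | exact: Qs].
by rewrite expn1; apply: leq_trans X_ge.
Qed.

Lemma wp_rset a e s (Q : state R -> Prop) : (ncost a + rcost e < 100)%N ->
  Q (setr s (neval (nmem s) a) (reval D s e)) -> wp (RSet a e) 1 s Q.
Proof.
move=> h Qs; eexists; eexists; split; [exact: ExRSet | | exact: Qs].
by rewrite expn1; apply: leq_trans X_ge.
Qed.

Lemma wp_emit e s (Q : state R -> Prop) : (ncost e < 100)%N ->
  Q (State (nmem s) (rmem s) (rcons (out s) (neval (nmem s) e))) ->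
  wp (Emit e) 1 s Q.
Proof.
move=> h Qs; eexists; eexists; split; [exact: ExEmit | | exact: Qs].
by rewrite expn1; apply: leq_trans X_ge.
Qed.

(** One extra factor [X >= 2] absorbs the sum of the two costs. *)
Lemma wp_seq c1 c2 e1 e2 s (Q : state R -> Prop) :
  wp c1 e1 s (fun s1 => wp c2 e2 s1 Q) -> wp (Seq c1 c2) (maxn e1 e2).+1 s Q.
Proof.
move=> [t1 [s1 [ex1 tX1 [t2 [s2 [ex2 tX2 Qs]]]]]].
exists (t1 + t2)%N, s2; split=> //; first exact: ExSeq ex1 ex2.
have h1 : (X ^ e1 <= X ^ maxn e1 e2)%N by rewrite leq_pexp2l // leq_maxl.
have h2 : (X ^ e2 <= X ^ maxn e1 e2)%N by rewrite leq_pexp2l // leq_maxr.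
by rewrite expnS; nia.
Qed.

Lemma wp_if b c1 c2 e1 e2 s (Q : state R -> Prop) : (bcost b < 50)%N ->
  (beval D s b -> wp c1 e1 s Q) -> (~~ beval D s b -> wp c2 e2 s Q) ->
  wp (If b c1 c2) (maxn e1 e2).+1 s Q.
Proof.
move=> hb h1 h2.
have [t [s' [ex tX Qs]]] : wp (if beval D s b then c1 else c2) (maxn e1 e2) s Q.
  case: ifP => hbs.
    by apply: wp_mono (h1 hbs); rewrite ?leq_maxl.
  by apply: wp_mono (h2 (negbT hbs)); rewrite ?leq_maxr.
exists (bcost b + t).+1, s'; split=> //; first exact: ExIf.
have : (0 < X ^ maxn e1 e2)%N by rewrite expn_gt0 X_gt0.
rewrite expnS; nia.
Qed.

(** [Inv] is indexed by the number of rounds done, and [N] bounds that number. The total cost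
    [N (X^e + 50) + 50] is at most [100 X^(e+1)], and [X >= 100]. *)
Lemma wp_while b c e s (N : nat) (Inv : nat -> state R -> Prop)
    (Q : state R -> Prop) : (bcost b < 50)%N -> (N <= X)%N ->
  Inv 0%N s ->
  (forall j s', agrees (While b c) s s' -> Inv j s' -> beval D s' b ->
     (j < N)%N /\ wp c e s' (Inv j.+1)) ->
  (forall j s', agrees (While b c) s s' -> Inv j s' -> ~~ beval D s' b -> Q s') ->
  wp (While b c) (e + 3) s Q.
Proof.
move=> hb NX I0 step final.
have Xe : (0 < X ^ e)%N by rewrite expn_gt0 X_gt0.
(* Induction on the number [m] of rounds that remain. *)
have main m j s' : agrees (While b c) s s' -> Inv j s' -> (j <= N)%N -> m = (N - j)%N ->
    exists t s'', [/\ exec D (While b c) s' t s'', (t <= m * (X ^ e + 50) + 50)%N & Q s''].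
  elim: m j s' => [|m IH] j s' ag Ij jN hm.
    case: (boolP (beval D s' b)) => hbs.
      by have [jN' _] := step _ _ ag Ij hbs; lia.
    exists (bcost b).+1, s'; split; [|lia|exact: (final _ _ ag Ij hbs)].
    exact: ExWhileF (negbTE hbs).
  case: (boolP (beval D s' b)) => hbs; last first.
    exists (bcost b).+1, s'; split; [|lia|exact: (final _ _ ag Ij hbs)].
    exact: ExWhileF (negbTE hbs).
  have [jN' [t [s1 [ex1 tX I1]]]] := step _ _ ag Ij hbs.
  have ag1 : agrees (While b c) s s1 by apply: agrees_trans ag (exec_agrees ex1).
  have [||t2 [s2 [ex2 tX2 Qs]]] := IH j.+1 s1 ag1 I1; [by []|lia|].
  exists (bcost b + t + t2).+1, s2; split=> //; first exact: ExWhileT hbs ex1 ex2.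
  rewrite mulSn; lia.
have [t [s' [ex tX Qs]]] := main N 0%N s (agrees_refl _ _) I0 (leq0n _) (esym (subn0 _)).
exists t, s'; split=> //; apply: leq_trans tX _.
have h1 : (N * (X ^ e + 50) + 50 <= X * (X ^ e * 51) + 50)%N.
  by rewrite leq_add2r leq_mul //; lia.
apply: leq_trans h1 _.
rewrite addn3 !expnS.
have h2 : (100 * 1 <= X * X ^ e)%N by rewrite leq_mul.
have h3 : (100 * (X * X ^ e) <= X * (X * X ^ e))%N by rewrite leq_mul2r X_ge orbT.
have h4 : (X * (X * X ^ e) <= X * (X * (X * X ^ e)))%N by rewrite leq_pmull.
lia.
Qed.

(** The increment of the counter is folded into the postcondition of the body, so each use only
    treats the body itself. *)
Lemma wp_for i b c e s (N : nat) (Inv : nat -> state R -> Prop)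
    (Q : state R -> Prop) :
  ~~ nwrites c i -> ~~ nwrites c b -> b != i -> (N <= X)%N -> nmem s b = N ->
  Inv 0%N (setn s i 0) ->
  (forall j s', (j < N)%N -> nmem s' i = j -> agrees (For i b c) s s' ->
     Inv j s' -> wp c e s' (fun s1 => Inv j.+1 (setn s1 i j.+1))) ->
  (forall s', agrees (For i b c) s s' -> Inv N s' -> Q s') ->
  wp (For i b c) (e + 6) s Q.
Proof.
move=> ci cb bi NX sb I0 step final.
apply: (@wp_mono _ (maxn 1 ((maxn e 1).+1 + 3)).+1) => [|s' _ h|]; [lia|exact: h|].
apply: wp_seq; apply: wp_nset => //=.
have ag0 s1 : agrees (For i b c) s (setn s i 0) ->
   agrees (While (BNot (BNLe (var b) (var i)))
             (Seq c (NSet (NLit i) (NAdd (var i) (NLit 1))))) (setn s i 0) s1 ->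
   agrees (For i b c) s s1.
  move=> ag [h1 h2 h3]; apply: agrees_trans ag _.
  split=> [x|x|] /=; first by rewrite negb_or => /andP[_]; exact: h1.
    by exact: h2.
  by exact: h3.
have ag1 : agrees (For i b c) s (setn s i 0).
  by split=> //= x; rewrite negb_or /upd => /andP[/negbTE ->].
apply: (@wp_while _ _ _ _ N (fun j s' => [/\ nmem s' i = j, (j <= N)%N & Inv j s'])) => //.
- by split=> //=; rewrite /upd eqxx.
- move=> j s' ag [sj jN Ij] /=; rewrite -ltnNge sj.
  have ag' := ag0 _ ag1 ag.
  have -> : nmem s' b = N by rewrite (agn ag') //= (negbTE cb) (negbTE bi).
  move=> jN'; split=> //; apply: wp_seq.
  apply: wp_mono (step _ _ jN' sj ag' Ij) => // s2 ag2 I2.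
  apply: wp_nset => //=.
  have s2i : nmem s2 i = j by rewrite (agn ag2).
  by rewrite s2i addn1; split=> //=; rewrite /upd eqxx.
- move=> j s' ag [sj jN Ij] /=; rewrite negbK sj.
  have ag' := ag0 _ ag1 ag.
  have -> : nmem s' b = N by rewrite (agn ag') //= (negbTE cb) (negbTE bi).
  move=> Nj; apply: final => //.
  by have -> : N = j by lia.
Qed.

End Exec.

Arguments wp_while {R n D X} X_ge {b c e s} N Inv {Q}.
Arguments wp_for {R n D X} X_ge {i b c e s} N Inv {Q}.

(** * The algorithm *)

Local Notation "c1 ;; c2" := (Seq c1 c2) (at level 61, right associativity).

(* Natural cells; the guessed digits are stored from address 40 on. *)
Local Notation xn := 0%N (only parsing).
Local Notation xp := 1%N (only parsing).
Local Notation xM := 2%N (only parsing).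
Local Notation xL := 3%N (only parsing).
Local Notation xW := 4%N (only parsing).
Local Notation xk := 5%N (only parsing).
Local Notation xB := 6%N (only parsing).
Local Notation xm := 7%N (only parsing).
Local Notation xG := 8%N (only parsing).
Local Notation xq := 9%N (only parsing).
Local Notation xg := 10%N (only parsing).
Local Notation xi := 11%N (only parsing).
Local Notation xu := 12%N (only parsing).
Local Notation xv := 13%N (only parsing).
Local Notation xj := 14%N (only parsing).
Local Notation xa := 15%N (only parsing).
Local Notation xd := 16%N (only parsing).
Local Notation xh := 17%N (only parsing).
Local Notation xz := 18%N (only parsing).
Local Notation xc := 19%N (only parsing).
(* Real cells; the 0/1 flags of the current and of the best candidate are
   interleaved at addresses 10 + 2u and 11 + 2u. *)
Local Notation ysc := 0%N (only parsing).
Local Notation ybest := 1%N (only parsing).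
Local Notation ycur := 2%N (only parsing).
Local Notation ymax := 3%N (only parsing).

Definition nset (x : nat) (e : nexp) : cmd := NSet (NLit x) e.
Definition rset (x : nat) (e : rexp) : cmd := RSet (NLit x) e.
Definition rvar (x : nat) : rexp := RMem (NLit x).
Definition digit (e : nexp) : nexp := NAdd (NLit 40) e.
Definition flag (e : nexp) : nexp := NAdd (NLit 10) (NAdd e e).
Definition bflag (e : nexp) : nexp := NAdd (NLit 11) (NAdd e e).

(* Divides cell xa in place: the remainder replaces it, the quotient goes to xd. *)
Definition Div (b : nat) : cmd :=
  nset xd (NLit 0) ;;
  While (BNLe (var b) (var xa))
    (nset xa (NSub (var xa) (var b)) ;; nset xd (NAdd (var xd) (NLit 1))).

Definition Mul (dst i b x : nat) : cmd :=
  nset dst (NLit 0) ;; For i b (nset dst (NAdd (var dst) (var x))).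

Definition SetLog : cmd :=
  nset xW (NLit 1) ;; nset xL (NLit 0) ;;
  While (BNot (BNLe (var xn) (var xW)))
    (nset xW (NAdd (var xW) (var xW)) ;; nset xL (NAdd (var xL) (NLit 1))).

Definition Pow : cmd :=
  nset xG (NLit 1) ;; For xi xm (Mul xc xj xB xG ;; nset xG (var xc)).

(** The base [B = 3 M n] exceeds every digit of a right guess: indices are below [n], weights are at
    most [2 M p], thresholds are at most [n]. Hence [G = B^m] guesses with [m = 3 k] digits
    suffice. *)
Definition Setup (M : nat) : cmd :=
  nset xM (NLit M) ;; SetLog ;; Mul xk xi xM xL ;;
  Mul xB xi xM xn ;; nset xB (NAdd (var xB) (NAdd (var xB) (var xB))) ;;
  nset xm (NAdd (var xk) (NAdd (var xk) (var xk))) ;;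
  Pow ;; nset xa (var xp) ;; Div xM ;; nset xq (NAdd (var xd) (NLit 1)).

(* The digits in base xB of the guess xg are the sample (0 .. k-1), its weights
   (k .. 2k-1) and the thresholds of the groups (2k .. 3k-1). *)
Definition Decode : cmd :=
  nset xa (var xg) ;;
  For xi xm (Div xB ;; NSet (digit (var xi)) (var xa) ;; nset xa (var xd)).

Definition Clear : cmd := For xu xn (RSet (flag (var xu)) (RNat (NLit 0))).

(** The greedy score is scaled by [k M], which avoids dividing the estimate and keeps the order of
    candidates. *)
Definition Score : cmd :=
  rset ysc (RNat (NLit 0)) ;;
  For xu xn (rset ysc (RAdd (rvar ysc) (RMul (RMem (flag (var xu))) (RIn (var xv) (var xu))))) ;;
  rset ysc (RMul (rvar ysc) (RMul (RNat (var xk)) (RNat (var xM)))) ;;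
  For xi xk
    (If (BNLe (var xh) (NMem (digit (var xi))))
       (rset ysc (RAdd (rvar ysc) (RMul (RNat (NMem (digit (NAdd (var xk) (var xi)))))
                                     (RIn (var xv) (NMem (digit (var xi)))))))
       Skip).

Definition Rminus1 : rexp := RSub (RNat (NLit 0)) (RNat (NLit 1)).

(* Points above the threshold get priority -1, so that wrong guesses still yield
   sets of size p. *)
Definition Select : cmd :=
  rset ybest Rminus1 ;;
  For xv xn
    (If (BRLe (RMem (flag (var xv))) (RNat (NLit 0)))
       (If (BNot (BNLe (var xh) (var xv))) Score (rset ysc Rminus1) ;;
        If (BRLe (rvar ybest) (rvar ysc))
          (rset ybest (rvar ysc) ;; nset xz (var xv))
          Skip)
       Skip).

Definition Greedy : cmd :=
  For xj xp
    (nset xa (var xj) ;; Div xq ;;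
     nset xh (NMem (digit (NAdd (NAdd (var xk) (var xk)) (var xd)))) ;;
     Select ;; RSet (flag (var xz)) (RNat (NLit 1))).

(** The sum runs over ordered pairs, so candidates are compared by [weight], twice the
    dispersion. *)
Definition Disp : cmd :=
  rset ycur (RNat (NLit 0)) ;;
  For xu xn (For xv xn
    (rset ycur (RAdd (rvar ycur)
       (RMul (RMul (RMem (flag (var xu))) (RMem (flag (var xv)))) (RIn (var xu) (var xv)))))).

(** The comparison is non-strict so that the first candidate always replaces the initial value 0. *)
Definition Update : cmd :=
  If (BRLe (rvar ymax) (rvar ycur))
    (rset ymax (rvar ycur) ;;
     For xu xn (RSet (bflag (var xu)) (RMem (flag (var xu)))))
    Skip.

Definition Output : cmd :=
  For xu xn (If (BRLe (RNat (NLit 1)) (RMem (bflag (var xu)))) (Emit (var xu)) Skip).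

Definition Program (M : nat) : cmd :=
  Setup M ;; For xg xG (Decode ;; Clear ;; Greedy ;; Disp ;; Update) ;; Output.

Ltac withX := lazymatch goal with h : is_true (leq 100%N _) |- _ => exact h end.
Ltac wseq := eapply wp_seq; [withX|].
Ltac wnset := eapply wp_nset; [withX|by []|rewrite /=].
Ltac wrset := eapply wp_rset; [withX|by []|rewrite /=].
Ltac wif := eapply wp_if; [withX|by []|rewrite /=|rewrite /=].
Ltac wskip := eapply wp_skip; [withX|].
Ltac wmono t := eapply wp_mono; [withX|exact: leqnn| |t].

(** * Correctness and cost of the arithmetic routines *)

Section Arith.
Variables (R : realType) (n : nat) (D : 'M[R]_n) (X : nat).
Hypothesis X_ge : (100 <= X)%N.
Local Notation wp := (wp D X).
Implicit Types (s : state R).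

Lemma wp_le c e e' s (Q : state R -> Prop) : wp c e s Q -> (e <= e')%N -> wp c e' s Q.
Proof. by move=> h ee; apply: (wp_mono X_ge ee) h. Qed.

Lemma wp_div b s : b != xa -> b != xd -> (0 < nmem s b)%N -> (nmem s xa <= X)%N ->
  wp (Div b) 8 s (fun s' => nmem s' xa = (nmem s xa %% nmem s b)%N /\
                            nmem s' xd = (nmem s xa %/ nmem s b)%N).
Proof.
move=> ba bd b0 aX; eapply wp_le.
wseq; wnset.
eapply (wp_while X_ge (nmem s xa) (fun j s' =>
  [/\ nmem s' xa = (nmem s xa - j * nmem s b)%N, nmem s' xd = j &
      (j * nmem s b <= nmem s xa)%N])); [by []|by []| | | ].
- by rewrite mul0n subn0.
- move=> j s' ag [ha hd hj] /= hle.
  have hb : nmem s' b = nmem s b by rewrite (agn ag) /=  ?negb_or ?ba ?bd //= /upd (negbTE bd).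
  rewrite hb ha in hle.
  split; first by nia.
  wseq; wnset; wnset.
  rewrite /upd /= ha hd hb; split; [rewrite mulSn; lia | lia | rewrite mulSn; lia].
- move=> j s' ag [ha hd hj] /= hle.
  have hb : nmem s' b = nmem s b by rewrite (agn ag) /=  ?negb_or ?ba ?bd //= /upd (negbTE bd).
  rewrite hb ha -ltnNge in hle.
  have e : nmem s xa = (j * nmem s b + (nmem s xa - j * nmem s b))%N by lia.
  rewrite ha hd {2 3}e modnMDl modn_small // divnMDl // divn_small // addn0 //.
by [].
Qed.

Lemma wp_mul dst i b x s : (nmem s b <= X)%N ->
  uniq [:: dst; i; b] -> x != dst -> x != i ->
  wp (Mul dst i b x) 8 s (fun s' => nmem s' dst = (nmem s b * nmem s x)%N).
Proof.
rewrite /= !inE !negb_or => bX /andP[/andP[di db] /andP[ib _]] xd xi.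
eapply wp_le.
wseq; wnset.
eapply (wp_for X_ge (nmem s b) (fun j s' => nmem s' dst = (j * nmem s x)%N));
  [by rewrite /= eq_sym|by rewrite /= eq_sym|by rewrite /= eq_sym| | | | |] => //=.
- by rewrite /upd eq_sym (negbTE db).
- by rewrite /upd (negbTE di) eqxx.
- move=> j s' jN sj ag hd; wnset.
  have hx : nmem s' x = nmem s x.
    by rewrite (agn ag) /= /upd ?negb_or ?xi ?xd // (negbTE xd).
  by rewrite /upd (negbTE di) eqxx hd hx mulSn addnC.
by [].
Qed.

(** Each doubling starts from a value below [n], so at exit [2^(L-1) < n <= 2^L]; [L = 0] is
    excluded by [n > 1]. *)
Lemma wp_setlog s : (1 < nmem s xn <= X)%N ->
  wp SetLog 9 s (fun s' => nmem s' xL = up_log 2 (nmem s xn)).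
Proof.
move=> /andP[n1 nX]; eapply wp_le.
wseq; wnset; wseq; wnset.
eapply (wp_while X_ge (nmem s xn) (fun j s' =>
  [/\ nmem s' xW = (2 ^ j)%N, nmem s' xL = j &
      (0 < j)%N -> (2 ^ j.-1 < nmem s xn)%N])); [by []|by []|by []| | ].
- move=> j s' ag [hW hL hj] /=.
  rewrite hW (agn ag) // /upd /= -ltnNge => hlt.
  split; first by apply: leq_trans hlt; exact: ltnW (ltn_expl _ _).
  wseq; wnset; wnset; rewrite /upd /= hW hL addn1; split=> //.
  by rewrite expnS; lia.
- move=> j s' ag [hW hL hj] /=.
  rewrite hW hL (agn ag) // /upd /= negbK => hle.
  case: j hj hle {hW hL} => [|j] hj hle; first by rewrite ltnNge hle in n1.
  by rewrite (@up_log_eq 2 j) // hle andbT hj.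
by [].
Qed.

Lemma wp_pow s : (nmem s xB <= X)%N -> (nmem s xm <= X)%N ->
  wp Pow 17 s (fun s' => nmem s' xG = (nmem s xB ^ nmem s xm)%N).
Proof.
move=> BX mX; eapply wp_le.
wseq; wnset.
eapply (wp_for X_ge (nmem s xm) (fun j s' => nmem s' xG = (nmem s xB ^ j)%N)) => //=.
  move=> j s' jm sj ag hG.
  have hB : nmem s' xB = nmem s xB by rewrite (agn ag).
  wseq; wmono ltac:(apply: wp_mul => //; by rewrite hB).
  move=> s1 ag1 h1; wnset.
  by rewrite /upd /= h1 hB hG expnS.
by [].
Qed.

Lemma wp_setup (N p M : nat) (L := up_log 2 N) (k := (M * L)%N)
    (B := (3 * (M * N))%N) :
  (1 < N <= X)%N -> (0 < M <= X)%N -> (p <= X)%N -> (B <= X)%N -> (3 * k <= X)%N ->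
  wp (Setup M) 30 (init_state R N p) (fun s =>
    [/\ [/\ nmem s xn = N, nmem s xp = p & nmem s xM = M],
        [/\ nmem s xk = k, nmem s xB = B & nmem s xm = (3 * k)%N],
        nmem s xG = (B ^ (3 * k))%N, nmem s xq = (p %/ M).+1 &
        rmem s ymax = 0 /\ out s = [::]]).
Proof.
move=> /andP[N1 NX] /andP[M0 MX] pX BX mX.
eapply wp_le.
wseq; wnset.
wseq; wmono ltac:(by apply: wp_setlog; rewrite /= /upd /= N1 NX).
move=> s1 ag1 /=; rewrite /upd /= -/L => hL.
wseq; wmono ltac:(by apply: wp_mul; rewrite ?(agn ag1)).
move=> s2 ag2; rewrite hL (agn ag1) // /upd /= -/k => hk.
have e0 : nmem s2 xn = N by rewrite (agn ag2) // (agn ag1).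
have e2 : nmem s2 xM = M by rewrite (agn ag2) // (agn ag1).
have e1 : nmem s2 xp = p by rewrite (agn ag2) // (agn ag1).
wseq; wmono ltac:(by apply: wp_mul; rewrite ?e2).
move=> s3 ag3; rewrite e0 e2 => hB.
have hk3 : nmem s3 xk = k by rewrite (agn ag3).
have eB : (M * N + (M * N + M * N))%N = B by rewrite /B; lia.
have em : (k + (k + k))%N = (3 * k)%N by lia.
wseq; wnset; wseq; wnset; rewrite /upd /= hk3 hB eB em.
wseq; wmono ltac:(by apply: wp_pow; rewrite /= /upd /=).
move=> s4 ag4; rewrite /= /upd /= => hG.
wseq; wnset.
have e4 x : x \in [:: xn; xp; xM; xk] -> nmem s4 x = nmem s3 x.
  by rewrite !inE => /or4P[] /eqP ->; rewrite (agn ag4).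
wseq; wmono ltac:(by apply: wp_div; rewrite //= /upd /= ?e4 ?(agn ag3) ?e2 ?e1).
move=> s5 ag5 /=; rewrite /upd /= !e4 // !(agn ag3) // e1 e2 => -[_ hq].
wnset; rewrite /upd /= hq addn1 !(agn ag5) // /= /upd /= hG.
rewrite !(agn ag4) //= /upd /= hk3 !(agn ag3) // e0 e1 e2.
have r5 : rmem s5 ymax = 0.
  by rewrite (agr ag5) // (agr ag4) // (agr ag3) // (agr ag2) // (agr ag1).
have o5 : out s5 = [::].
  by rewrite (ago ag5) // (ago ag4) // (ago ag3) // (ago ag2) // (ago ag1).
by [].
by [].
Qed.

End Arith.
Ltac wle := eapply wp_le; [withX| |].

(** * Correctness and cost of the search over all guesses *)

Section Search.
Variables (R : realType) (U : finType) (d : U -> U -> R) (X : nat).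
Hypothesis d_metric : is_metric d.
Hypothesis X_ge : (100 <= X)%N.
Local Notation D := (dist_matrix d).
Local Notation wp := (wp D X).
Implicit Types (s : state R) (S : {set U}).

Variables (p M k B q : nat).
Hypothesis nX : (#|U| <= X)%N.
Hypothesis pX : (p <= X)%N.
Hypothesis mX : (3 * k <= X)%N.
Hypothesis B_gt0 : (0 < B)%N.
Hypothesis q_gt0 : (0 < q)%N.

Definition ctx s : Prop :=
  [/\ nmem s xn = #|U|, nmem s xp = p, nmem s xM = M &
      [/\ nmem s xk = k, nmem s xB = B, nmem s xm = (3 * k)%N & nmem s xq = q]].

Lemma ctx_agrees c s s' :
  agrees c s s' -> ~~ has (nwrites c) [:: xn; xp; xM; xk; xB; xm; xq] ->
  ctx s -> ctx s'.
Proof.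
move=> ag; rewrite /= !negb_or andbT => /and4P[h0 h1 h2 /and4P[h5 h6 h7 h9]].
by rewrite /ctx !(agn ag).
Qed.

Lemma rank_surj j : (j < #|U|)%N -> exists x : U, j = enum_rank x.
Proof. by move=> jn; exists (enum_val (Ordinal jn)); rewrite enum_valK. Qed.

Lemma sum_rank (F : nat -> R) :
  \sum_(0 <= i < #|U|) F i = \sum_(x : U) F (enum_rank x).
Proof.
rewrite big_mkord (reindex (@enum_rank U)) //=.
by exists enum_val => x _; [rewrite enum_rankK | rewrite enum_valK].
Qed.

Lemma entry_rank x y : entry D (enum_rank x) (enum_rank y) = d x y.
Proof. by rewrite /entry !valK mxE !enum_rankK. Qed.

Lemma entry_ge0 i j : 0 <= entry D i j.
Proof.
rewrite /entry; case: insubP => // i' _ _; case: insubP => // j' _ _.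
by rewrite mxE; case: d_metric.
Qed.

Definition flags s S : Prop :=
  forall x, rmem s (10 + (enum_rank x + enum_rank x)) = (x \in S)%:R.
Definition bflags s S : Prop :=
  forall x, rmem s (11 + (enum_rank x + enum_rank x)) = (x \in S)%:R.
Definition digits s (g : nat -> nat) : Prop :=
  forall i, (i < 3 * k)%N -> nmem s (40 + i) = g i.

Lemma flags_agrees c s s' S : agrees c s s' ->
  (forall x, (10 <= x)%N -> ~~ rwrites c x) -> flags s S -> flags s' S.
Proof. by move=> ag h f x; rewrite (agr ag) ?h. Qed.

Lemma digits_agrees c s s' g : agrees c s s' ->
  (forall x, (40 <= x)%N -> ~~ nwrites c x) -> digits s g -> digits s' g.
Proof. by move=> ag h f i ik; rewrite (agn ag) ?f // h // leq_addr. Qed.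

Lemma wp_decode s : ctx s -> (nmem s xg <= X)%N ->
  wp Decode 20 s (fun s' => digits s' (fun i => (nmem s xg %/ B ^ i) %% B)%N).
Proof.
move=> cx gX; wle.
wseq; wnset.
eapply (wp_for X_ge (3 * k)%N (fun j s' => nmem s' xa = (nmem s xg %/ B ^ j)%N /\
  forall i, (i < j)%N -> nmem s' (40 + i) = ((nmem s xg %/ B ^ i) %% B)%N)) => //=.
- by case: cx => _ _ _ [].
- by rewrite /= /upd /= expn0 divn1.
- move=> j s' jm sj ag [ha hd].
  have hB : nmem s' xB = B by rewrite (agn ag) //; case: cx => _ _ _ [].
  wseq; wmono ltac:(by apply: wp_div; rewrite // ?hB // ha; apply: leq_trans gX; exact: leq_div).
  move=> s1 ag1; rewrite hB ha => -[ha1 hd1].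
  have j1 : nmem s1 xi = j by rewrite (agn ag1).
  wseq; wnset; wnset; rewrite j1 ha1 /upd /= hd1; split.
    by rewrite expnSr divnMA.
  move=> i; rewrite ltnS leq_eqVlt => /orP[/eqP ->|ij]; rewrite ?eqxx //.
  rewrite eqn_add2l (ltn_eqF ij) (agn ag1) //.
  exact: hd.
- by move=> s' _ [].
by [].
Qed.

Lemma wp_clear s : ctx s -> wp Clear 7 s (fun s' => flags s' set0 /\
   forall x, rmem s' (11 + (x + x)) = rmem s (11 + (x + x))).
Proof.
move=> cx; wle.
eapply (wp_for X_ge #|U| (fun j s' =>
  (forall i, (i < j)%N -> rmem s' (10 + (i + i)) = 0) /\
  forall x, rmem s' (11 + (x + x)) = rmem s (11 + (x + x)))) => //=.
- by case: cx.
- move=> j s' jn sj ag [h1 h2]; wrset; rewrite sj; split=> [i|x]; rewrite /= /upd /=.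
    rewrite ltnS leq_eqVlt => /orP[/eqP ->|ij]; rewrite ?eqxx //.
    by case: eqP => // _; exact: h1.
  by case: eqP => [|_]; [lia | exact: h2].
- move=> s' ag [h1 h2]; split=> // x.
  by rewrite h1 ?inE.
by [].
Qed.

Definition score (g : nat -> nat) (h : nat) S (v : U) : R :=
  dist_to d v S * (k%:R * M%:R) +
  \sum_(i < k) (if (h <= g i)%N then (g (k + i)%N)%:R * entry D (enum_rank v) (g i) else 0).

(** Membership by natural index, so that loop invariants can be sums over initial segments of
    [0 .. n - 1]. *)
Definition rank_in S (i : nat) : bool :=
  if insub i is Some i' then enum_val (i' : 'I_#|U|) \in S else false.

Lemma rank_inE S x : rank_in S (enum_rank x) = (x \in S).
Proof. by rewrite /rank_in valK enum_rankK. Qed.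

Lemma dist_to_flags v S :
  dist_to d v S =
  \sum_(0 <= i < #|U|) (rank_in S i)%:R * entry D (enum_rank v) i.
Proof.
rewrite sum_rank /dist_to big_mkcond; apply: eq_bigr => x _.
by rewrite rank_inE entry_rank; case: (x \in S); rewrite ?mul1r ?mul0r.
Qed.

Lemma wp_score s g h S v : ctx s -> digits s g -> flags s S ->
  nmem s xv = enum_rank v -> nmem s xh = h ->
  wp Score 12 s (fun s' => rmem s' ysc = score g h S v).
Proof.
move=> cx dg fl sv sh; wle.
wseq; wrset; wseq.
eapply (wp_for X_ge #|U| (fun j s' => rmem s' ysc =
    \sum_(0 <= i < j) (rank_in S i)%:R * entry D (enum_rank v) i)) => //=.
- by case: cx.
- by rewrite big_geq.
- move=> j s' jn sj ag hs; wrset.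
  rewrite sj hs big_nat_recr //= /upd /=; congr (_ + _ * _).
    have [x jx] := rank_surj jn.
    by rewrite jx (agr ag) //= /upd /= fl rank_inE.
  by rewrite (agn ag) //= sv.
move=> s1 ag1; rewrite -dist_to_flags => h1.
wseq; wrset.
have k1 : nmem s1 xk = k by rewrite (agn ag1) //; case: cx => _ _ _ [].
have M1 : nmem s1 xM = M by rewrite (agn ag1) //; case: cx.
eapply (wp_for X_ge k (fun j s' => rmem s' ysc = dist_to d v S * (k%:R * M%:R) +
   \sum_(0 <= i < j) (if (h <= g i)%N
      then (g (k + i)%N)%:R * entry D (enum_rank v) (g i) else 0))) => //=.
- by lia.
- by rewrite /= /upd /= h1 k1 M1 big_geq ?addr0.
- move=> j s' jk sj ag hs.
  have dig i : (i < 3 * k)%N -> nmem s' (40 + i) = g i.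
    by move=> ik; rewrite (agn ag) //= (agn ag1) //= dg.
  have hh : nmem s' xh = h by rewrite (agn ag) //= (agn ag1).
  have hv : nmem s' xv = enum_rank v by rewrite (agn ag) //= (agn ag1).
  have hk : nmem s' xk = k by rewrite (agn ag).
  wif; rewrite hh sj dig; try lia; move=> hc.
    wrset; rewrite /= /upd /= hs sj hk hv !dig; try lia.
    by rewrite big_nat_recr //= hc addrA.
  by wskip; rewrite /= hs big_nat_recr //= (negbTE hc) addr0.
- by move=> s' ag ->; rewrite /score big_mkord.
by [].
Qed.


Lemma score_ge0 g h S v : 0 <= score g h S v.
Proof.
rewrite addr_ge0 // ?mulr_ge0 ?dist_to_ge0 // sumr_ge0 // => i _.
by case: ifP => // _; rewrite mulr_ge0 // entry_ge0.
Qed.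

Definition priority (g : nat -> nat) (h : nat) S (v : U) : R :=
  if (enum_rank v < h)%N then score g h S v else - 1.

Lemma priority_geN1 g h S v : - 1 <= priority g h S v.
Proof.
by rewrite /priority; case: ifP => // _; have := score_ge0 g h S v; lra.
Qed.

Lemma wp_select s g h S : ctx s -> digits s g -> flags s S -> nmem s xh = h ->
  (exists x, x \notin S) ->
  wp Select 25 s (fun s' => exists z, [/\ nmem s' xz = enum_rank z, z \notin S &
    forall v, v \notin S -> priority g h S v <= priority g h S z]).
Proof.
move=> cx dg fl sh [x0 x0S]; wle.
wseq; wrset.
eapply (wp_for X_ge #|U| (fun j s' =>
  ((forall x, (enum_rank x < j)%N -> x \in S) /\ rmem s' ybest = - 1) \/
  exists z, [/\ nmem s' xz = enum_rank z, z \notin S,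
    rmem s' ybest = priority g h S z &
    forall v, (enum_rank v < j)%N -> v \notin S -> priority g h S v <= priority g h S z])) => //=.
- by case: cx.
- by left; split=> //; rewrite /= /upd /= sub0r.
- move=> j s' jn sj ag Ij.
  have cx' : ctx s' by apply: ctx_agrees ag _ _.
  have fl' : flags s' S by apply: flags_agrees ag _ _ => //= -[|[|x]].
  have dg' : digits s' g by apply: digits_agrees ag _ _ => // x /= h40; rewrite !negb_or; lia.
  have sh' : nmem s' xh = h by rewrite (agn ag).
  have [x jx] := rank_surj jn; rewrite {}jx {jn} in sj Ij *.
  have rk v : (enum_rank v < (enum_rank x).+1)%N -> v = x \/ (enum_rank v < enum_rank x)%N.
    rewrite ltnS leq_eqVlt => /orP[/eqP hv|]; last by right.
    by left; apply: enum_rank_inj; apply: val_inj; rewrite /= hv.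
  wif; rewrite sj fl'.
    case: (boolP (x \in S)) => [_|xS _]; first by rewrite ler10.
    wseq.
    have hsc : wp (If (BNot (BNLe (var xh) (var xv))) Score (rset ysc Rminus1)) 13 s'
        (fun s1 => rmem s1 ysc = priority g h S x).
      wle; first wif; rewrite ?sh' ?sj -?ltnNge /priority.
      + by move=> ->; apply: wp_score; rewrite ?sj.
      + by rewrite ltnS leqNgt => /negbTE ->; wrset; rewrite /= /upd /= sub0r.
      by [].
    wmono ltac:(exact: hsc).
    move=> s1 ag1 h1.
    have b1 : rmem s1 ybest = rmem s' ybest by rewrite (agr ag1).
    have v1 : nmem s1 xv = enum_rank x by rewrite (agn ag1) // sj.
    have z1 : nmem s1 xz = nmem s' xz by rewrite (agn ag1).
    wif; rewrite h1 b1.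
      move=> hle; wseq; wrset; wnset; right; exists x.
      rewrite /= /upd /= h1 v1; split=> // v /rk[-> //|vj] vS.
      case: Ij => [[h2 _]|[z [_ _ hz h2]]]; first by rewrite h2 in vS.
      by apply: le_trans (h2 _ vj vS) _; rewrite -hz.
    rewrite -ltNge => hlt; wskip; right.
    case: Ij => [[_ h2]|[z [zz zS hz h2]]].
      by have := priority_geN1 g h S x; rewrite leNgt -h2 hlt.
    exists z; rewrite /= /upd /= z1 b1; split=> // v /rk[->|vj] vS; last exact: h2.
    by rewrite ltW // -hz.
  case: (boolP (x \in S)) => [xS _|_]; last by rewrite lexx.
  wskip; case: Ij => [[h1 h2]|[z [zz zS hz h2]]].
    by left; split=> // v /rk[-> //|]; exact: h1.
  right; exists z; split=> // v /rk[->|vj] vS; last exact: h2.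
  by rewrite xS in vS.
- move=> s' ag [[h1 _]|[z [zz zS _ h2]]].
    by rewrite h1 in x0S.
  by exists z; split=> // v; exact: h2.
by [].
Qed.

Hypothesis p_n : (p <= #|U|)%N.
Hypothesis p_kq : (p <= k * q)%N.

(** [J] stands for any property that greedy choices preserve, which separates the program from the
    exchange argument. The size of the result is tracked for arbitrary digits, so wrong guesses are
    covered too. *)
Lemma wp_greedy s g (J : nat -> {set U} -> Prop) :
  ctx s -> digits s g -> flags s set0 -> J 0%N set0 ->
  (forall j S z, (j < p)%N -> J j S -> z \notin S ->
    (forall v, v \notin S -> priority g (g (k + k + j %/ q)%N) S v <=
                             priority g (g (k + k + j %/ q)%N) S z) ->
    J j.+1 (z |: S)) ->
  wp Greedy 40 s (fun s' => (exists S, [/\ flags s' S, #|S| = p & J p S]) /\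
    forall x, rmem s' (11 + (x + x)) = rmem s (11 + (x + x))).
Proof.
move=> cx dg fl J0 Jstep; wle.
eapply (wp_for X_ge p (fun j s' => (exists S, [/\ flags s' S, #|S| = j & J j S]) /\
    forall x, rmem s' (11 + (x + x)) = rmem s (11 + (x + x)))) => //=.
- by case: cx.
- by split=> //; exists set0; rewrite cards0.
- move=> j s' jp sj ag [[S [fl' cS Jj]] hb].
  have cx' : ctx s' by apply: ctx_agrees ag _ _.
  have dg' : digits s' g by apply: digits_agrees ag _ _ => // x /= h40; rewrite !negb_or; lia.
  wseq; wnset; wseq; wmono ltac:(apply: wp_div; rewrite //= /upd /= ?sj;
    [by case: cx' => _ _ _ [_ _ _ ->] | by apply: leq_trans pX; exact: ltnW]).
  move=> s1 ag1; rewrite /= /upd /= sj => -[_].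
  have -> : nmem s' xq = q by case: cx' => _ _ _ [].
  move=> hd.
  have cx1 : ctx s1 by apply: ctx_agrees ag1 _ _.
  have dg1 : digits s1 g.
    apply: (digits_agrees ag1) => [x /= h40|i ik]; first by rewrite !negb_or; lia.
    by rewrite /= /upd /= dg'.
  have fl1 : flags s1 S by apply: flags_agrees ag1 _ _.
  wseq; wnset.
  have -> : nmem s1 xk = k by case: cx1 => _ _ _ [].
  rewrite hd dg1; last first.
    (* There are at most [k] groups, so the threshold digit is among the [3 k] decoded ones. *)
    have : (j %/ q < k)%N by rewrite ltn_divLR //; apply: leq_trans p_kq.
    lia.
  wseq; wmono ltac:(apply: (@wp_select _ g (g (k + k + j %/ q)%N) S) => //).
  + move=> s2 ag2 [z [hz zS hmax]]; wrset; rewrite hz; split; last first.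
      (* Current flags have even addresses and best flags odd ones, so they cannot collide. *)
      move=> x; rewrite /= /upd /=; case: eqP => [|_]; first lia.
      by rewrite (agr ag2) //= (agr ag1) //= hb.
    exists (z |: S); split; last by apply: Jstep.
      move=> x; rewrite /= /upd /= in_setU1; case: (eqVneq x z) => [->|xz]; first by rewrite eqxx.
      case: eqP => [h|_].
        by case/eqP: xz; apply: enum_rank_inj; apply: val_inj => /=; lia.
      by rewrite (agr ag2) //= fl1.
    by rewrite cardsU1 zS cS.
  have : (0 < #|~: S|)%N by rewrite cardsCs setCK cS subn_gt0; apply: leq_trans p_n.
  by case/card_gt0P => x; rewrite inE => xS; exists x.
by [].
Qed.

Lemma weight_flags S : weight d S =
  \sum_(0 <= i < #|U|) \sum_(0 <= j < #|U|)
     (rank_in S i)%:R * (rank_in S j)%:R * entry D i j.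
Proof.
rewrite sum_rank /weight big_mkcond; apply: eq_bigr => x _.
rewrite sum_rank rank_inE; case: (x \in S); last first.
  by rewrite big1 // => y _; rewrite !mul0r.
rewrite /dist_to big_mkcond; apply: eq_bigr => y _.
by rewrite rank_inE entry_rank; case: (y \in S); rewrite ?mul1r ?mul0r.
Qed.

Lemma wp_disp s S : ctx s -> flags s S ->
  wp Disp 14 s (fun s' => rmem s' ycur = weight d S).
Proof.
move=> cx fl; wle.
wseq; wrset.
have flE s' u : flags s' S -> (u < #|U|)%N -> rmem s' (10 + (u + u)) = (rank_in S u)%:R.
  by move=> f /rank_surj[x ->]; rewrite f rank_inE.
eapply (wp_for X_ge #|U| (fun i s' => rmem s' ycur =
  \sum_(0 <= i' < i) \sum_(0 <= j < #|U|)
     (rank_in S i')%:R * (rank_in S j)%:R * entry D i' j)) => //=.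
- by case: cx.
- by rewrite big_geq.
- move=> i s' iN si ag hi.
  have fl' : flags s' S by move=> x; rewrite (agr ag) //= /upd /= fl.
  eapply (wp_for X_ge #|U| (fun j s1 => rmem s1 ycur = rmem s' ycur +
     \sum_(0 <= j' < j) (rank_in S i)%:R * (rank_in S j')%:R * entry D i j')) => //=.
  + by rewrite (agn ag) //=; case: cx.
  + by rewrite big_geq ?addr0.
  + move=> j s1 jN sj ag1 hj.
    have fl1 : flags s1 S by move=> x; rewrite (agr ag1) //= fl'.
    wrset; rewrite /= /upd /= hj sj (agn ag1) //= si !flE //.
    by rewrite big_nat_recr //= addrA.
  by move=> s1 ag1 /= ->; rewrite /= hi [in RHS]big_nat_recr.
- by move=> s' _ ->; rewrite weight_flags.
by [].
Qed.

Lemma wp_update s S : ctx s -> flags s S -> rmem s ycur = weight d S ->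
  wp Update 9 s (fun s' => if rmem s ymax <= weight d S
     then bflags s' S /\ rmem s' ymax = weight d S
     else s' = s).
Proof.
move=> cx fl hc; wle.
wif; rewrite hc => hle; last by wskip; rewrite (negbTE hle).
wseq; wrset; rewrite hle.
eapply (wp_for X_ge #|U| (fun j s' => [/\ flags s' S,
   forall x, (enum_rank x < j)%N -> rmem s' (11 + (enum_rank x + enum_rank x)) = (x \in S)%:R &
   rmem s' ymax = weight d S])) => //=.
- by case: cx.
- move=> j s' jN sj ag [fl' hb hm].
  have [x jx] := rank_surj jN.
  wrset; rewrite sj jx fl'; split.
  + by move=> y; rewrite /= /upd /=; case: eqP => [|_]; [lia | exact: fl'].
  + move=> y; rewrite ltnS leq_eqVlt /upd /= => /orP[/eqP e|yx].
      by rewrite e eqxx; congr (_ \in S)%:R; apply: enum_rank_inj; apply: val_inj.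
    by case: eqP => [|_]; [lia | apply: hb; rewrite jx].
  + by rewrite /= /upd /= hm.
- by move=> s' ag [_ hb hm]; split=> // x; apply: hb.
by [].
Qed.

Definition listed S (j : nat) : seq nat := [seq i <- iota 0 j | rank_in S i].

Lemma listedS S j : listed S j.+1 = if rank_in S j then rcons (listed S j) j else listed S j.
Proof.
rewrite /listed -addn1 iotaD filter_cat /= add0n.
by case: ifP; rewrite ?cats1 ?cats0.
Qed.

Lemma wp_output s S : ctx s -> bflags s S -> out s = [::] ->
  wp Output 12 s (fun s' => perm_eq (out s') [seq (enum_rank u : nat) | u in S]).
Proof.
move=> cx fl o0; wle.
eapply (wp_for X_ge #|U| (fun j s' => out s' = listed S j)) => //=.
- by case: cx.
- move=> j s' jN sj ag ho.
  have [x jx] := rank_surj jN.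
  have hb : rmem s' (11 + (j + j)) = (x \in S)%:R by rewrite (agr ag) // jx fl.
  have rj : rank_in S j = (x \in S) by rewrite jx rank_inE.
  wif; rewrite sj hb listedS rj; case: (x \in S) => //=.
  + move=> _; eapply wp_emit; [withX|by []|].
    by rewrite /= ho sj.
  + by rewrite ler10.
  + by rewrite lexx.
  + by move=> _; wskip; rewrite /= ho.
- move=> s' ag ->; apply: uniq_perm.
  + by rewrite filter_uniq // iota_uniq.
  + by rewrite map_inj_uniq ?enum_uniq // => x y /val_inj/enum_rank_inj.
  move=> i; rewrite mem_filter mem_iota /= add0n.
  apply/andP/mapP => [[iS iN]|[x xS ->]].
    have [x ix] := rank_surj iN; rewrite ix rank_inE in iS *.
    by exists x => //; rewrite mem_enum.
  by rewrite rank_inE ltn_ord -mem_enum.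
by [].
Qed.


Lemma wp_search s (G good : nat) (tgt : R) g (J : nat -> {set U} -> Prop) :
  ctx s -> nmem s xG = G -> (good < G <= X)%N -> rmem s ymax = 0 ->
  (forall i, (i < 3 * k)%N -> ((good %/ B ^ i) %% B)%N = g i) ->
  J 0%N set0 ->
  (forall j S z, (j < p)%N -> J j S -> z \notin S ->
    (forall v, v \notin S -> priority g (g (k + k + j %/ q)%N) S v <=
                             priority g (g (k + k + j %/ q)%N) S z) ->
    J j.+1 (z |: S)) ->
  (forall S, #|S| = p -> J p S -> tgt <= weight d S) ->
  wp (For xg xG (Decode ;; Clear ;; Greedy ;; Disp ;; Update)) 60 s
    (fun s' => exists S, [/\ bflags s' S, #|S| = p & tgt <= weight d S]).
Proof.
move=> cx sG /andP[goodG GX] m0 hg J0 Jstep Jtgt; wle.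
(* Once the counter has passed [good], the best set reaches the target; later updates never lower
   its weight. *)
eapply (wp_for X_ge G (fun c s' => (c = 0%N -> rmem s' ymax = 0) /\
  ((0 < c)%N -> exists S, [/\ bflags s' S, #|S| = p, rmem s' ymax = weight d S &
     (good < c)%N -> tgt <= weight d S]))) => //=.
- move=> c s' cG sc ag [I0 I1].
  have cx' : ctx s' by apply: ctx_agrees ag _ _.
  wseq; wmono ltac:(apply: wp_decode; rewrite // sc; exact: leq_trans (ltnW cG) GX).
  rewrite sc => s1 ag1 dg1.
  have cx1 : ctx s1 by apply: ctx_agrees ag1 _ _.
  wseq; wmono ltac:(exact: wp_clear).
  move=> s2 ag2 [fl2 b2].
  have cx2 : ctx s2 by apply: ctx_agrees ag2 _ _.
  have dg2 : digits s2 (fun i => (c %/ B ^ i) %% B)%N.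
    by apply: digits_agrees ag2 _ _ => // x /= h40; rewrite !negb_or; lia.
  (* The invariant is demanded only when the current guess is the right one. *)
  wseq; wmono ltac:(apply: (@wp_greedy _ (fun i => (c %/ B ^ i) %% B)%N
                             (fun j S => c = good -> J j S)) => //).
  + move=> s3 ag3 [[S [fl3 cS JS]] b3].
    have cx3 : ctx s3 by apply: ctx_agrees ag3 _ _.
    wseq; wmono ltac:(apply: wp_disp fl3 => //).
    move=> s4 ag4 h4.
    have cx4 : ctx s4 by apply: ctx_agrees ag4 _ _.
    have fl4 : flags s4 S by apply: flags_agrees ag4 _ _ => // -[|[|[|x]]].
    have m4 : rmem s4 ymax = rmem s' ymax.
      by rewrite (agr ag4) // (agr ag3) // (agr ag2) // (agr ag1).
    wmono ltac:(apply: (@wp_update _ S) => //).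
    rewrite m4 => s5 ag5 h5; split=> // _.
    case: ifP h5 => hle h5.
      case: h5 => bf m5; exists S; split=> //.
      rewrite ltnS leq_eqVlt => /orP[/eqP e|gc]; first by apply: Jtgt => //; apply: JS.
      have [|T [_ _ hT1 hT2]] := I1; first by case: (c) gc.
      by apply: le_trans (hT2 gc) _; rewrite -hT1.
    (* A rejected candidate cannot be the first, since [ymax] was 0 then and weights are
       nonnegative. *)
    have c0 : (0 < c)%N.
      rewrite lt0n; apply/eqP => c0; move: hle; rewrite I0 //.
      by rewrite (weight_ge0 d_metric).
    have [//|T [bf cT hT1 hT2]] := I1.
    exists T; rewrite h5; split=> //=.
    * by move=> x; rewrite /= (agr ag4) //= b3 b2 (agr ag1) ?bf.
    * by rewrite m4.
    rewrite ltnS leq_eqVlt => /orP[/eqP e|gc]; last exact: hT2.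
    apply: le_trans (Jtgt _ cS (JS (esym e))) _.
    by rewrite -hT1 ltW // ltNge hle.
  move=> j S z jp hJ zS hz cg; apply: Jstep => //; first exact: hJ.
  move=> v vS; have := hz v vS; rewrite cg /=.
  have jk : (k + k + j %/ q < 3 * k)%N.
    have : (j %/ q < k)%N by rewrite ltn_divLR //; apply: leq_trans p_kq.
    lia.
  rewrite hg //.
  have pE h w : priority (fun i => (good %/ B ^ i) %% B)%N h S w = priority g h S w.
    rewrite /priority /score; case: ifP => // _; congr (_ + _).
    apply: eq_bigr => i _; rewrite !hg //; have := ltn_ord i; lia.
  by rewrite !pE.
- move=> s' ag [_ I1]; have [|T [bf cT _ hT]] := I1; first exact: leq_trans goodG.
  by exists T; split=> //; apply: hT.
by [].
Qed.

End Search.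

(** Taking [X] to be the number of guesses makes it dominate all other sizes, so the running time is
    a fixed power of that number. *)
Lemma wp_program (R : realType) (U : finType) (d : U -> U -> R) (X p M : nat)
    (L := up_log 2 #|U|) (k := (M * L)%N) (B := (3 * (M * #|U|))%N)
    (q := (p %/ M).+1) (good : nat) (tgt : R) (g : nat -> nat)
    (J : nat -> {set U} -> Prop) :
  is_metric d -> (100 <= X)%N -> (1 < #|U|)%N -> (0 < M)%N -> (p <= #|U|)%N ->
  X = (B ^ (3 * k))%N -> (good < X)%N ->
  (forall i, (i < 3 * k)%N -> ((good %/ B ^ i) %% B)%N = g i) ->
  J 0%N set0 ->
  (forall j S z, (j < p)%N -> J j S -> z \notin S ->
    (forall v, v \notin S -> priority d M k g (g (k + k + j %/ q)%N) S v <=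
                             priority d M k g (g (k + k + j %/ q)%N) S z) ->
    J j.+1 (z |: S)) ->
  (forall S : {set U}, #|S| = p -> J p S -> tgt <= weight d S) ->
  wp (dist_matrix d) X (Program M) 62 (init_state R #|U| p) (fun s =>
    exists S : {set U}, [/\ perm_eq (out s) [seq (enum_rank u : nat) | u in S],
                  #|S| = p & tgt <= weight d S]).
Proof.
move=> dm X_ge n1 M0 pn XE goodX hg J0 Jstep Jtgt.
have L0 : (0 < L)%N by rewrite up_log_gt0.
have k0 : (0 < k)%N by rewrite muln_gt0 M0.
have B1 : (1 < B)%N by rewrite /B; nia.
have BX : (B <= X)%N by rewrite XE -{1}(expn1 B) leq_exp2l //; lia.
have nB : (#|U| <= B)%N by rewrite /B; nia.
have MB : (M <= B)%N by rewrite /B; nia.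
have mX : (3 * k <= X)%N by rewrite XE; apply: ltnW; apply: ltn_expl.
have nX : (#|U| <= X)%N by apply: leq_trans BX.
have pX : (p <= X)%N by apply: leq_trans nX.
wle.
wseq; wmono ltac:(apply: (@wp_setup _ _ _ _ X_ge #|U| p M); rewrite ?n1 ?nX ?M0 //;
  exact: leq_trans BX).
move=> s1 ag1 [[e0 e1 e2] [e5 e6 e7] e8 e9 [m1 o1]].
have cx1 : ctx U p M k B q s1 by [].
have p_kq : (p <= k * q)%N.
  rewrite /k /q; have := divn_eq p M; have := ltn_pmod p M0.
  have : (1 * (M * (p %/ M).+1) <= L * (M * (p %/ M).+1))%N by rewrite leq_mul2r L0 orbT.
  by clear; nia.
wseq; wmono ltac:(apply: (@wp_search _ _ _ _ dm X_ge p M k B q _ _ _ _ _ _ _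
                           s1 X good tgt g J) => //).
- move=> s2 ag2 [S [bf cS hS]].
  have cx2 : ctx U p M k B q s2 by apply: ctx_agrees ag2 _ _.
  wmono ltac:(apply: (wp_output d X_ge nX cx2 bf); by rewrite (ago ag2)).
  by move=> s3 ag3 hp; exists S.
- exact: ltnW.
- by rewrite e8 -XE.
- by rewrite goodX leqnn.
by [].
Qed.

(** * Approximation and running time *)

Lemma digits_exist (B m : nat) (f : nat -> nat) :
  (forall i, (i < m)%N -> (f i < B)%N) ->
  exists2 c, (c < B ^ m)%N & forall i, (i < m)%N -> ((c %/ B ^ i) %% B)%N = f i.
Proof.
elim: m f => [|m IH] f fB; first by exists 0%N.
have [c cB hc] := IH (fun i => f i.+1) (fun i im => fB i.+1 im).
have f0 : (f 0%N < B)%N by apply: fB.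
exists (c * B + f 0)%N; first by rewrite expnSr; nia.
case=> [|i] im; first by rewrite expn0 divn1 modnMDl modn_small.
rewrite expnS divnMA divnMDl; last by apply: leq_ltn_trans f0.
by rewrite (divn_small f0) addn0 hc.
Qed.

Lemma exists_opt (R : realType) (U : finType) (d : U -> U -> R) (p : nat) :
  is_metric d -> (p <= #|U|)%N ->
  exists O : {set U}, [/\ #|O| = p,
    forall S : {set U}, #|S| = p -> weight d S <= weight d O &
    max_disp d p <= disp d O].
Proof.
move=> dm pn.
have [S0 cS0] : exists S0 : {set U}, #|S0| == p.
  have [S0 _ /eqP] : exists2 S0 : {set U}, S0 \subset [set: U] & #|S0| == p.
    have : (0 < #|[set A : {set U} | (A \subset [set: U]) && (#|A| == p)]|)%N.
      by rewrite cards_draws bin_gt0 cardsT.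
    by case/card_gt0P => A; rewrite inE => /andP[h1 h2]; exists A.
  by exists S0; apply/eqP.
case: (@arg_maxP _ _ _ S0 (fun S : {set U} => #|S| == p) (weight d) cS0) => O /eqP cO Omax.
have Om (S : {set U}) : #|S| = p -> weight d S <= weight d O by move=> /eqP; exact: Omax.
exists O; split=> //.
have dispE S : disp d S = weight d S / 2 by rewrite (weight_disp dm); field.
apply: bigmax_le => [|S /eqP cS].
  by rewrite dispE divr_ge0 // weight_ge0.
by rewrite !dispE ler_pM2r // Om.
Qed.

Lemma max_disp_ge0 (R : realType) (U : finType) (d : U -> U -> R) (p : nat) :
  0 <= max_disp d p.
Proof. exact: bigmax_ge_id. Qed.

(** With [a = 2^L >= 2], the left side is at most [2 a (a + 1) < 4 a^2 <= a^4], and [2 <= expR 1].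
    This is the union bound over points, thresholds and signs. *)
Lemma sample_size_bound (R : realType) (n L : nat) : (1 < n)%N -> (n <= 2 ^ L)%N ->
  2 * (n%:R * n.+1%:R) < expR (4 * L%:R) :> R.
Proof.
move=> n1 nL.
have h : (2 * (n * n.+1) < 2 ^ (4 * L))%N.
  have -> : (2 ^ (4 * L) = (2 ^ L) ^ 4)%N by rewrite -expnM mulnC.
  move: (2 ^ L)%N nL => a na.
  have h1 : (2 * (n * n.+1) <= 2 * (a * a.+1))%N by rewrite leq_mul2l leq_mul.
  apply: leq_ltn_trans h1 _; have a2 : (2 <= a)%N by apply: leq_trans na.
  have h2 : (4 * (a * a) <= (a * a) * (a * a))%N by rewrite leq_mul2r; nia.
  rewrite !expnS expn0; nia.
apply: (@lt_le_trans _ _ ((2 ^ (4 * L))%N%:R)).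
  by rewrite -!natrM ltr_nat.
rewrite -natrM -[X in expR X]mulr1 expRM_natl natrX.
apply: lerXn2r; rewrite ?nnegrE ?expR_ge0 //.
exact: expR_ge1Dx.
Qed.

(* The constant 512 * 324 = 4 * 72 * 24 ^ 2 makes the sampling error
   delta = eps / 24 work: k delta ^ 2 / 72 >= 4 L. *)
Lemma program_approx (R : realType) (eps : R) (M : nat) (U : finType)
    (d : U -> U -> R) (p : nat) (X := ((3 * (M * #|U|)) ^ (3 * (M * up_log 2 #|U|)))%N) :
  0 < eps <= 1 -> 512 * 324 <= M%:R * eps ^+ 2 ->
  is_metric d -> (2 <= p)%N -> (p <= #|U|)%N ->
  wp (dist_matrix d) X (Program M) 62 (init_state R #|U| p) (fun s =>
    exists S : {set U}, [/\ perm_eq (out s) [seq (enum_rank u : nat) | u in S],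
                  #|S| = p & (1 - eps) * max_disp d p <= disp d S]).
Proof.
move=> /andP[e0 e1] hM dm p2 pn.
case: (exists_opt dm pn) => O [cO Omax Odisp].
have n1 : (1 < #|U|)%N by apply: leq_trans pn.
have M0R : 0 < M%:R :> R.
  rewrite ltNge; apply/negP => h; have := sqr_ge0 eps => h'.
  have : M%:R * eps ^+ 2 <= 0 by rewrite mulr_le0_ge0.
  lra.
have M0 : (0 < M)%N by rewrite -(ltr0n R).
set L := up_log 2 #|U|.
have L0 : (0 < L)%N by rewrite up_log_gt0.
have nL : (#|U| <= 2 ^ L)%N by case/andP: (up_log_bounds (isT : (1 < 2)%N) n1).
pose k := (M * L)%N; pose B := (3 * (M * #|U|))%N; pose q := (p %/ M).+1.
have k0 : (0 < k)%N by rewrite muln_gt0 M0.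
pose delta := eps / 24.
have delta0 : 0 <= delta by rewrite /delta; lra.
have r_inj : injective (fun x : U => (enum_rank x : nat)) by move=> x y /val_inj/enum_rank_inj.
have r_lt (x : U) : (enum_rank x < #|U|)%N by [].
have [thr [thr_card thr_anti thr_le]] := exists_threshold cO r_inj r_lt.
have Me : M%:R * eps ^+ 2 <= M%:R * eps by rewrite ler_pM2l //; nra.
have [w [A [A_le est]]] : exists (w : nat -> U) (A : nat -> nat),
    (forall i, (A i <= 2 * M * p)%N) /\
    forall v h, (h <= #|U|)%N ->
    `|(\sum_(i < k) (if (h <= enum_rank (w i))%N then (A i)%:R * d v (w i) else 0)) /
       (k%:R * M%:R) - dist_to d v (above O (fun x => enum_rank x : nat) h)|
      <= est_err d O p delta v.
  apply: (exists_estimator dm p2 cO _ delta0) => //.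
  - by rewrite /delta; apply/andP; split; lra.
  - by rewrite /delta; lra.
  apply: lt_le_trans (sample_size_bound _ n1 nL) _.
  rewrite ler_expR /k natrM /delta.
  have : 512 * 324 * L%:R <= M%:R * eps ^+ 2 * L%:R :> R by rewrite ler_wpM2r.
  lra.
(* The digits of the right guess: sample indices, then weights, then one threshold per group. *)
pose g i := if (i < k)%N then (enum_rank (w i) : nat) else if (i < k + k)%N then A (i - k)%N
            else thr (p - (i - (k + k)).+1 * q)%N.
have nB : (#|U| < B)%N by rewrite /B; clear -M0 n1; nia.
have [good goodX hg] : exists2 c, (c < B ^ (3 * k))%N &
    forall i, (i < 3 * k)%N -> ((c %/ B ^ i) %% B)%N = g i.
  apply: digits_exist => i _; rewrite /g; case: ifP => _; first exact: ltn_trans nB.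
  case: ifP => _; last by apply: leq_ltn_trans nB.
  by apply: leq_ltn_trans (A_le _) _; rewrite /B; clear -M0 n1 pn; nia.
pose hyb j S := exists P, hybrid d O p (fun x => enum_rank x : nat) q delta thr j S P.
have kM0 : 0 < k%:R * M%:R :> R by rewrite mulr_gt0 // ltr0n.
(* Since [M >= 1] and [n >= 2], the base is at least 6 and the exponent at least 3. *)
have X_ge : (100 <= X)%N.
  rewrite /X -/B -/k; apply: (@leq_trans (6 ^ 3)) => //.
  have B6 : (6 <= B)%N by apply: (@leq_mul 3 2 3) => //; apply: (@leq_mul 1 2).
  apply: (@leq_trans (B ^ 3)%N); first by rewrite leq_exp2r.
  by rewrite leq_pexp2l ?(leq_trans _ B6) // -[leqLHS]muln1 leq_mul2l k0.
apply: wp_mono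
  (@wp_program R U d X p M good ((1 - eps) * weight d O) g hyb
     _ _ _ _ _ _ _ _ _ _ _) => //.
- move=> s _ [S [hp cS hS]]; exists S; split=> //.
  move: hS; rewrite !(weight_disp dm).
  have : (1 - eps) * max_disp d p <= (1 - eps) * disp d O by rewrite ler_wpM2l //; lra.
  lra.
- by exists O; apply: hybrid0.
- move=> j S z jp [P hP] zS hz.
  have [x xS xh] := hybrid_avail (ltn0Sn _) thr_card jp hP.
  have gE : g (k + k + j %/ q)%N = step_thr p q thr j.
    by rewrite /g /step_thr !ltnNge leq_addr (leq_trans _ (leq_addr _ _)) ?leq_addr //= addKn.
  rewrite -/k -/q gE in hz.
  have zh : (enum_rank z < step_thr p q thr j)%N.
    apply/negPn/negP => nzh; have := hz x xS; rewrite /priority xh (negbTE nzh).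
    have := score_ge0 dm M k g (step_thr p q thr j) S x; lra.
  have sc v : priority d M k g (step_thr p q thr j) S v / (k%:R * M%:R) =
     if (enum_rank v < step_thr p q thr j)%N then
      dist_to d v S + (\sum_(i < k) (if (step_thr p q thr j <= enum_rank (w i))%N
        then (A i)%:R * d v (w i) else 0)) / (k%:R * M%:R)
     else - 1 / (k%:R * M%:R).
    rewrite /priority; case: ifP => // _; rewrite /score mulrDl mulfK ?gt_eqF //.
    congr (_ + _ / _); apply: eq_bigr => i _.
    rewrite /g ltn_ord ltnNge leq_addr /= ltn_add2l ltn_ord addKn.
    by case: ifP => // _; rewrite entry_rank.
  have [||P' hP'] := @hybrid_step R U d dm O p p2 cO _ q delta thr (ltn0Sn _)
      delta0 thr_card thr_anti j S P
      (fun v => dist_to d v S + (\sum_(i < k) (if (step_thr p q thr j <= enum_rank (w i))%N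
        then (A i)%:R * d v (w i) else 0)) / (k%:R * M%:R)) z jp hP zS zh.
  + move=> v vS vh; have := hz v vS.
    rewrite -(ler_pM2r (x := (k%:R * M%:R)^-1)) ?invr_gt0 //.
    by rewrite !sc vh zh.
  + move=> v; rewrite opprD addrACA subrr add0r; apply: est.
    exact: thr_le.
  by exists P'.
move=> S cS [P hP].
apply: le_trans (hybrid_end dm p2 cO Omax delta0 hP).
apply: ler_wpM2r; first exact: weight_ge0.
have p0 : 0 < p%:R :> R by rewrite ltr0n; apply: leq_trans p2.
(* Here [q - 1 <= p / M]. The two losses are then [4 eps / 8] and [12 eps / 24], together [eps]. *)
have hq : q.-1%:R / p%:R <= eps / 8.
  rewrite ler_pdivrMr // /q /=.
  have h1 : (p %/ M)%:R * M%:R <= p%:R :> R by rewrite -natrM ler_nat leq_divM.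
  have h2 : 8 <= M%:R * eps by lra.
  have h3 : (p %/ M)%:R * 8 <= (p %/ M)%:R * (M%:R * eps) :> R by rewrite ler_wpM2l.
  have h4 : (p %/ M)%:R * M%:R * eps <= p%:R * eps :> R by rewrite ler_wpM2r // ltW.
  lra.
rewrite /delta; lra.
Qed.

Lemma ln2_ge_half (R : realType) : 2^-1 <= ln 2 :> R.
Proof.
rewrite -ler_expR lnK ?posrE //.
have h := expR_ge1Dx (- 2^-1 : R); have e0 := expR_gt0 (2^-1 : R).
move: h; rewrite expRN => h.
have := ler_wpM2r (ltW e0) h; rewrite mulVf ?gt_eqF //; lra.
Qed.

(** In logarithms: [L <= 4 ln n], [ln B <= 7 M ln n] and [M^2 <= (512 * 325)^2 / eps^4], so
    [3 M L e ln B <= 84 e M^2 (ln n)^2]. One factor [ln n] goes into the base [n] of the power. *)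
Lemma time_bound (R : realType) (eps : R) (n M e : nat) : 0 < eps ->
  (1 < n)%N -> (0 < M)%N -> M%:R * eps ^+ 2 <= 512 * 325 ->
  (((3 * (M * n)) ^ (3 * (M * up_log 2 n))) ^ e)%N%:R <=
  n%:R `^ (84 * e%:R * (512 * 325) ^+ 2 * (ln n%:R / eps ^+ 4)) :> R.
Proof.
move=> e0 n1 M0 hM.
set L := up_log 2 n; set B := (3 * (M * n))%N.
have n0 : (0 < n)%N by apply: ltnW.
have n0R : 0 < n%:R :> R by rewrite ltr0n.
have M1R : 1 <= M%:R :> R by rewrite ler1n.
have B0R : 0 < B%:R :> R by rewrite ltr0n /B; nia.
set l := ln n%:R : R.
have l2 : 2^-1 <= l.
  by apply: le_trans (ln2_ge_half R) _; rewrite ler_ln ?posrE // ler_nat.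
have hL : L%:R <= 4 * l.
  have L0 : (0 < L)%N by rewrite up_log_gt0.
  have /andP[h _] := up_log_bounds (isT : (1 < 2)%N) n1.
  have : ln (2 ^ L.-1)%N%:R <= l by rewrite /l ler_ln ?posrE ?ltr0n ?expn_gt0 ?ler_nat // ltnW.
  rewrite natrX lnXn // -[_ *+ L.-1]mulr_natl => h1.
  have h2 : L.-1%:R * 2^-1 <= L.-1%:R * ln 2 :> R by rewrite ler_wpM2l // ln2_ge_half.
  rewrite -(prednK L0) -natr1; lra.
have hB : ln B%:R <= 7 * M%:R * l.
  rewrite /B mulnA natrM lnM ?posrE ?ltr0n ?muln_gt0 // -/l natrM.
  have : ln (3 * M%:R) <= 3 * M%:R :> R.
    have := @le_ln1Dx R (3 * M%:R - 1); rewrite addrCA subrr addr0 => h.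
    by apply: le_trans (h _) _; lra.
  have h1 : M%:R * 2^-1 <= M%:R * l by rewrite ler_wpM2l //; lra.
  have h2 : 1 * l <= M%:R * l by rewrite ler_wpM2r //; lra.
  lra.
rewrite -expnM natrX -powR_mulrn ?(ltW B0R) // /powR !gt_eqF // ler_expR -/l.
have e4 : 0 < eps ^+ 4 by rewrite exprn_gt0.
have hM2 : M%:R ^+ 2 <= (512 * 325) ^+ 2 / eps ^+ 4.
  rewrite ler_pdivlMr //.
  have -> : M%:R ^+ 2 * eps ^+ 4 = (M%:R * eps ^+ 2) ^+ 2 by ring.
  apply: lerXn2r hM; rewrite nnegrE; last by apply: mulr_ge0; exact: ler0n.
  by apply: mulr_ge0; [exact: ler0n | apply: exprn_ge0; exact: ltW].
have lB0 : 0 <= ln (B%:R : R) by rewrite ln_ge0 // ler1n -(ltr0n R).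
apply: (@le_trans _ _ ((3 * (M%:R * (4 * l)) * e%:R) * (7 * M%:R * l))).
  apply: ler_pM => //; rewrite !natrM.
  by apply: ler_wpM2r => //; apply: ler_wpM2l => //; apply: ler_wpM2l.
have -> : (3 * (M%:R * (4 * l)) * e%:R) * (7 * M%:R * l) =
  M%:R ^+ 2 * (84 * e%:R * l ^+ 2) by ring.
have -> : 84 * e%:R * (512 * 325) ^+ 2 * (l / eps ^+ 4) * l =
  (512 * 325) ^+ 2 / eps ^+ 4 * (84 * e%:R * l ^+ 2) by ring.
by apply: ler_wpM2r => //; rewrite mulr_ge0 ?sqr_ge0 // mulr_ge0.
Qed.

(** For [eps >= 1] the required value is at most 0, so any [p] points will do. *)
Definition EmitFirst : cmd := For 2 1 (Emit (var 2)).

Lemma wp_emit_first (R : realType) (n p X : nat) (D : 'M[R]_n) :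
  (100 <= X)%N -> (p <= X)%N ->
  wp D X EmitFirst 7 (init_state R n p) (fun s => out s = iota 0 p).
Proof.
move=> X_ge pX; wle.
eapply (wp_for X_ge p (fun j s => out s = iota 0 j)) => //.
move=> j s jp sj ag ho; eapply wp_emit; [withX|by []|].
by rewrite -[j.+1]addn1 iotaD /= ho sj cats1.
by [].
Qed.

Lemma emit_first_outputs (R : realType) (U : finType) (d : U -> U -> R) (p : nat) :
  (2 <= p)%N -> (p <= #|U|)%N ->
  exists (S : {set U}) (t : nat),
    [/\ outputs_in d p EmitFirst S t, #|S| = p & (t <= (#|U| ^ 7) ^ 7)%N].
Proof.
move=> p2 pn.
have n2 : (2 <= #|U|)%N by apply: leq_trans pn.
(* The cost rules need [X >= 100], and [2^7 = 128]. The resulting time [n^49] is where the bound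
   [49 <= C] comes from. *)
have X_ge : (100 <= #|U| ^ 7)%N by apply: (@leq_trans (2 ^ 7)) => //; rewrite leq_exp2r.
have pX : (p <= #|U| ^ 7)%N.
  by apply: leq_trans pn _; rewrite -{1}(expn1 #|U|) leq_pexp2l //; apply: ltnW.
have [t [s [ex tX os]]] := wp_emit_first (dist_matrix d) X_ge pX.
pose S := [set x : U | (enum_rank x < p)%N].
have perm : perm_eq (out s) [seq (enum_rank u : nat) | u in S].
  rewrite os; apply: uniq_perm; first exact: iota_uniq.
    by rewrite map_inj_uniq ?enum_uniq // => x y /val_inj/enum_rank_inj.
  move=> i; rewrite mem_iota add0n /=.
  apply/idP/mapP => [ip|[x xS ->]]; last by move: xS; rewrite mem_enum inE.
  have iU : (i < #|U|)%N by apply: leq_trans pn.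
  by exists (enum_val (Ordinal iU)); rewrite ?mem_enum ?inE enum_valK.
exists S, t; split=> //; first by exists s.
by have := perm_size perm; rewrite os size_iota size_map -cardE => <-.
Qed.

Theorem theorem3 (R : realType) :
  exists2 C : R, 0 < C &
  forall eps : R, 0 < eps ->
  exists c : cmd,
  forall (U : finType) (d : U -> U -> R) (p : nat),
    is_metric d -> (2 <= p)%N -> (p <= #|U|)%N ->
    exists (S : {set U}) (t : nat),
      [/\ outputs_in d p c S t,
          #|S| = p,
          disp d S >= (1 - eps) * max_disp d p
        & t%:R <= #|U|%:R `^ (C * Num.max 1 (ln #|U|%:R / eps ^+ 4))].
Proof.
pose C : R := 84 * 62%:R * (512 * 325) ^+ 2.
have C49 : 49 <= C by rewrite /C expr2; lra.
have C0 : 0 <= C by apply: le_trans C49.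
exists C; first by apply: lt_le_trans C49.
move=> eps e0; case: (leP 1 eps) => e1.
  exists EmitFirst => U d p dm p2 pn.
  have [S [t [hout cS ht]]] := emit_first_outputs d p2 pn.
  exists S, t; split=> //.
    apply: (@le_trans _ _ 0).
      by rewrite mulr_le0_ge0 ?max_disp_ge0 // subr_le0.
    by have := weight_ge0 dm S; rewrite (weight_disp dm) pmulr_rge0.
  apply: (@le_trans _ _ (((#|U| ^ 7) ^ 7)%N%:R)); first by rewrite ler_nat.
  have n1 : 1 <= #|U|%:R :> R by rewrite ler1n; apply: leq_trans pn; apply: ltnW.
  rewrite -expnM natrX -[leLHS]powR_mulrn //; apply: ler_powR => //.
  have : 1 <= Num.max 1 (ln #|U|%:R / eps ^+ 4) by rewrite le_max lexx.
  by move=> h; apply: le_trans C49 _; rewrite ler_peMr.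
pose K : R := 512 * 324 / eps ^+ 2.
(* [M] is the truncation of [K] plus one, so [M eps^2] exceeds [512 * 324] by at most [eps^2 <= 1]:
   large enough for accuracy, small enough for the running time. *)
have e2 : 0 < eps ^+ 2 by rewrite exprn_gt0.
have K0 : 0 <= K by apply: divr_ge0; [apply: mulr_ge0; exact: ler0n | exact: ltW].
pose M := (Num.truncn K).+1.
have /andP[hK1 hK2] := truncn_itv K0.
have hM1 : 512 * 324 <= M%:R * eps ^+ 2 by rewrite -ler_pdivrMr // ltW.
have hM2 : M%:R * eps ^+ 2 <= 512 * 325.
  have : (M%:R - 1) * eps ^+ 2 <= 512 * 324.
    by rewrite -ler_pdivlMr // /M -natr1 addrK.
  have : eps ^+ 2 <= 1 by rewrite expr_le1 // ltW.
  lra.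
exists (Program M) => U d p dm p2 pn.
have e01 : 0 < eps <= 1 by rewrite e0 ltW.
have [t [s [ex tX [S [hp cS hS]]]]] := program_approx e01 hM1 dm p2 pn.
exists S, t; split=> //; first by exists s.
have n1 : (1 < #|U|)%N by apply: leq_trans pn.
apply: (@le_trans _ _ (_%:R)); first by rewrite ler_nat; exact: tX.
apply: le_trans (time_bound 62 e0 n1 (ltn0Sn _) hM2) _.
apply: ler_powR; first by rewrite ler1n; apply: ltnW.
by rewrite ler_wpM2l // le_max lexx orbT.
Qed.
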